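(* Let $S_{\boldsymbol{\lambda}}$ be the (closed, densely defined) weighted shift, on the directed tree $\mathfrak{T}=(V,E)$ of sequences, with the weights $\boldsymbol{\lambda}$, all as described in the context. The operator $\Delta_t(S_{\boldsymbol{\lambda}}^* )$ is not closable for any $t\in(0,1)$.
   Context: Let $\mathbb{Z}_+=\{0,1,2,\ldots\}$. For a sequence $v:\mathbb{Z}\to\mathbb{Z}_+\cup\{-1\}$ put $m(v)=\inf\{n\in\mathbb{Z}:v_n\neq0\}-2$ and $M(v)=\sup\{n\in\mathbb{Z}:v_n>-1\}$. Let $$V=\{v:\mathbb{Z}\to\mathbb{Z}_+\cup\{-1\}\;:\;m(v)>-\infty,\ M(v)<\infty,\ v_n>-1\text{ for }n\le M(v)\},$$ $$E=\{(u,v)\in V\times V\;:\;M(v)=M(u)+1\text{ and }u_n=v_n\text{ for }n\le M(u)\}.$$ Then $\mathfrak{T}=(V,E)$ is a rootless directed tree in which every vertex has countably infinitely many children. For $u\in V$, $\mathrm{Chi}(u)=\{v\in V:(u,v)\in E\}$, and $\mathrm{par}(v)$ is the unique $u$ with $(u,v)\in E$. Define weights $\boldsymbol{\lambda}=\{\lambda_v\}_{v\in V}$ by $$\lambda_v=\frac{2^{v_{m(v)}+\ldots+v_{M(v)-1}}}{v_{M(v)}+1},\qquad v\in V.$$ $\ell^2(V)$ is the complex Hilbert space of square-summable functions $f:V\to\mathbb{C}$. The weighted shift $S_{\boldsymbol{\lambda}}$ is the operator in $\ell^2(V)$ with domain $$\mathcal{D}(S_{\boldsymbol{\lambda}})=\Big\{f\in\ell^2(V):\sum_{u\in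 V}\Big(\sum_{v\in\mathrm{Chi}(u)}|\lambda_v|^2\Big)|f(u)|^2<\infty\Big\}$$ (with $\infty\cdot0=0$) and $(S_{\boldsymbol{\lambda}}f)(v)=\lambda_vf(\mathrm{par}(v))$ for $v\in V$. This operator is closed and densely defined. For a closed densely defined operator $T$ in a Hilbert space with polar decomposition $T=U|T|$ ($|T|=(T^*T)^{1/2}$, $U$ a partial isometry with kernel $\mathcal{N}(T)$) and $t\in(0,1]$, the $t$-Aluthge transform is $\Delta_t(T)=|T|^tU|T|^{1-t}$ with the natural domain of the composition. An operator is closable if the closure of its graph is the graph of an operator. *)

(* Defs.v *)
From HB Require Import structures.
From mathcomp Require Import all_boot all_order all_algebra.
From mathcomp Require Import all_classical all_reals all_analysis.
From mathcomp Require Import complex.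
From mathcomp Require Import ring lra.
Set Implicit Arguments.
Unset Strict Implicit.
Unset Printing Implicit Defensive.
Import Order.TTheory GRing.Theory Num.Theory.
Import numFieldNormedType.Exports.
Local Open Scope classical_set_scope.
Local Open Scope ring_scope.
Local Open Scope complex_scope.

Section Ell2.
Variables (R : realType) (I : choiceType).
Implicit Types (f g : I -> R[i]).

Definition sqmod (z : R[i]) : R := Normc.normc z ^+ 2.

Definition sqsum f : \bar R := \esum_(i in [set: I]) (sqmod (f i))%:E.

Definition ell2_pred : {pred I -> R[i]} := fun f => `[< (sqsum f < +oo)%E >].

Lemma sqmod_ge0 z : 0 <= sqmod z. Proof. exact: sqr_ge0. Qed.

Lemma sqmodZ a z : sqmod (a * z) = sqmod a * sqmod z.
Proof. by rewrite /sqmod Normc.normcM exprMn. Qed.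

Lemma sqmodD (a b : R) (x y : R[i]) : 0 < a -> 0 < b ->
  sqmod (x + y) <= (1 + b / a) * sqmod x + (1 + a / b) * sqmod y.
Proof.
move=> a0 b0; rewrite /sqmod.
have nxy : 0 <= Normc.normc (x + y) by case: (x + y) => ? ?; exact: sqrtr_ge0.
have := le_normcD x y.
set u := Normc.normc x; set v := Normc.normc y => uv.
apply: (@le_trans _ _ ((u + v) ^+ 2)).
  by rewrite !expr2 ler_pM.
rewrite -subr_ge0.
have -> : (1 + b / a) * u ^+ 2 + (1 + a / b) * v ^+ 2 - (u + v) ^+ 2 =
   (b * u - a * v) ^+ 2 / (a * b) by field; rewrite !gt_eqF.
by rewrite mulr_ge0 ?sqr_ge0 // invr_ge0 mulr_ge0 // ltW.
Qed.

Lemma sqsum_ge0 f : (0 <= sqsum f)%E.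
Proof. by apply: esum_ge0 => i _; rewrite lee_fin sqmod_ge0. Qed.

Lemma esumZ (c : R) f : 0 <= c ->
  \esum_(i in [set: I]) (c * sqmod (f i))%:E = (c%:E * sqsum f)%E.
Proof.
rewrite le_eqVlt => /predU1P[<-|c0].
  by rewrite mul0e esum1 // => i _; rewrite mul0r.
rewrite /sqsum /esum -ereal_sup_pZl //.
congr ereal_sup; rewrite image_comp; apply: eq_imagel => A [finA _] /=.
rewrite !fsbig_finite //= ge0_sume_distrr // => i _.
by rewrite lee_fin sqmod_ge0.
Qed.

Lemma sqsumZ a f : sqsum (a *: f) = ((sqmod a)%:E * sqsum f)%E.
Proof.
rewrite -esumZ ?sqmod_ge0 //; apply: eq_esum => i _.
by rewrite -sqmodZ.
Qed.

Lemma sqsumD (a b : R) f g : 0 < a -> 0 < b ->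
  (sqsum (f + g)%R <= (1 + b / a)%:E * sqsum f + (1 + a / b)%:E * sqsum g)%E.
Proof.
move=> a0 b0.
have p0 x y : 0 < x -> 0 < y -> 0 <= 1 + x / y :> R.
  by move=> x0 y0; rewrite addr_ge0 // divr_ge0 // ltW.
rewrite -!esumZ ?p0 // -esumD; last 2 first.
- by move=> i _; rewrite lee_fin mulr_ge0 ?p0 ?sqmod_ge0.
- by move=> i _; rewrite lee_fin mulr_ge0 ?p0 ?sqmod_ge0.
by apply: le_esum => i _; rewrite -EFinD lee_fin; exact: sqmodD.
Qed.

Lemma ell2_submod : submod_closed ell2_pred.
Proof.
split.
  apply/asboolP; rewrite /sqsum esum1 ?ltry // => i _.
  by rewrite /sqmod Normc.normc0 expr0n.
move=> a f g /asboolP ff /asboolP gf; apply/asboolP.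
apply: (le_lt_trans (sqsumD (a *: f) g (@ltr01 R) (@ltr01 R))).
have c0 : 0 <= 1 + 1 / 1 :> R by rewrite divr1 addr_ge0.
by rewrite sqsumZ lte_add_pinfty ?lte_mul_pinfty ?lee_fin ?sqmod_ge0.
Qed.

HB.instance Definition _ :=
  GRing.isSubmodClosed.Build R[i] (I -> R[i]) ell2_pred ell2_submod.

Record ell2 := Ell2 { ell2_fun :> I -> R[i] ; _ : ell2_fun \in ell2_pred }.
HB.instance Definition _ := [isSub for ell2_fun].
HB.instance Definition _ := [Choice of ell2 by <:].
HB.instance Definition _ := [SubChoice_isSubLmodule of ell2 by <:].

Definition norm2 (f : ell2) : R[i] := (Num.sqrt (fine (sqsum f)))%:C.

Lemma sqsum_fin (f : ell2) : (sqsum f \is a fin_num)%E.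
Proof. by rewrite ge0_fin_numE ?sqsum_ge0 //; apply/asboolP; exact: valP f. Qed.

Lemma norm2_eq0 (f : ell2) : norm2 f = 0 -> f = 0.
Proof.
move=> [] /eqP; rewrite sqrtr_eq0 => f0.
have s0 : sqsum f = 0%E.
  apply/eqP; rewrite eq_le sqsum_ge0 andbT -(fineK (sqsum_fin f)).
  by rewrite lee_fin.
apply/val_inj/funext => i /=; apply: Normc.eq0_normc; apply/eqP.
rewrite -[_ == 0](@expf_eq0 _ _ 2) -[_ ^+ 2]/(sqmod _) eq_le sqmod_ge0 andbT.
rewrite -lee_fin -[leRHS]s0 -[leLHS](@esum_set1 _ _ i (fun i => (sqmod (f i))%:E)).
  rewrite (esum_mkcond [set i]) /sqsum; apply: le_esum => j _.
  by case: ifP => // _; rewrite lee_fin sqmod_ge0.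
by rewrite lee_fin sqmod_ge0.
Qed.

Lemma norm2Z (a : R[i]) (f : ell2) : norm2 (a *: f) = `|a| * norm2 f.
Proof.
rewrite /norm2 (_ : ell2_fun (a *: f) = a *: (f : I -> R[i])) //.
rewrite sqsumZ fineM ?sqsum_fin //= sqrtrM ?sqmod_ge0 //.
rewrite /sqmod sqrtr_sqr ger0_norm ?rmorphM //=.
by case: a => ? ?; exact: sqrtr_ge0.
Qed.

Lemma norm2D (f g : ell2) : norm2 (f + g) <= norm2 f + norm2 g.
Proof.
have sq0 (h : ell2) : 0 <= fine (sqsum h) by rewrite fine_ge0 ?sqsum_ge0.
set a := Num.sqrt (fine (sqsum f)); set b := Num.sqrt (fine (sqsum g)).
have norm20 (h : ell2) : Num.sqrt (fine (sqsum h)) = 0 -> h = 0.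
  by move=> h0; apply: norm2_eq0; rewrite /norm2 h0.
have [a0|a0] := eqVneq a 0.
  have -> : f = 0 by exact: norm20.
  by rewrite add0r lerDr lecR sqrtr_ge0.
have [b0|b0] := eqVneq b 0.
  have -> : g = 0 by exact: norm20.
  by rewrite addr0 lerDl lecR sqrtr_ge0.
have {}a0 : 0 < a by rewrite lt_def a0 sqrtr_ge0.
have {}b0 : 0 < b by rewrite lt_def b0 sqrtr_ge0.
rewrite /norm2 -rmorphD /= lecR -/a -/b.
have <- : Num.sqrt ((a + b) ^+ 2) = a + b.
  by rewrite sqrtr_sqr ger0_norm // addr_ge0 // ltW.
rewrite ler_sqrt ?sqr_ge0 //.
rewrite -lee_fin (fineK (sqsum_fin (f + g))).
apply: le_trans (sqsumD f g a0 b0) _.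
rewrite -(fineK (sqsum_fin f)) -(fineK (sqsum_fin g)) lee_fin.
rewrite -[fine (sqsum f)]sqr_sqrtr // -[fine (sqsum g)]sqr_sqrtr // -/a -/b.
rewrite le_eqVlt; apply/orP; left; apply/eqP.
by field; rewrite !gt_eqF.
Qed.

HB.instance Definition _ :=
  Lmodule_isNormed.Build R[i] ell2 norm2D norm2Z norm2_eq0.

End Ell2.

(* Unbounded operators in l^2(I) are represented by their graphs. *)
Section Operators.
Variables (R : realType) (I : choiceType).
Local Notation H := (ell2 R I).
Local Notation operator := (set (H * H)).
Implicit Types (f g h : H) (S T A : operator) (E : set R -> H -> H).

(* The unordered sum of an absolutely summable real family. *)
Definition rsum (a : I -> R) : R :=
  fine (\esum_(i in [set: I]) (Num.max (a i) 0)%:E)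
  - fine (\esum_(i in [set: I]) (Num.max (- a i) 0)%:E).

Definition dotp f g : R[i] :=
  let a i := f i * (g i)^* in
  rsum (fun i => complex.Re (a i)) +i* rsum (fun i => complex.Im (a i)).

Definition adjoint T : operator :=
  [set p | forall q, T q -> dotp q.2 p.1 = dotp q.1 p.2].

Definition okernel T : set H := [set f | T (f, 0)].

(* The closure is taken in the product of the norm topologies; single-valuedness
   is what makes the closure of a linear graph the graph of an operator. *)
Definition closable T : Prop :=
  forall f g g', closure T (f, g) -> closure T (f, g') -> g = g'.

Definition spectral_measure E : Prop :=
  [/\ forall B, measurable B ->
        [/\ linear (E B), forall f, E B (E B f) = E B f
          & forall f g, dotp (E B f) g = dotp f (E B g)],
      forall f, E [set: R] f = f
    & forall F : (set R)^nat, (forall n, measurable (F n)) ->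
        trivIset [set: nat] F ->
        forall f, \sum_(k < n) E (F k) f @[n --> \oo] --> E (\bigcup_n F n) f].

Definition spectral_mu E f : set R -> \bar R :=
  fun B => (complex.Re (dotp (E B f) f))%:E.

Definition spectral_dom E (phi : R -> R) : set H :=
  [set f | (\int[spectral_mu E f]_x ((phi x) ^+ 2)%:E < +oo)%E].

(* The integral of phi against the complex measure B |-> <E(B) f, h>, which is
   expressed through the positive measures <E(B) u, u> by polarization. *)
Definition spectral_form E (phi : R -> R) f h : R[i] :=
  4^-1 * \sum_(k < 4) 'i%C ^+ k *
    (fine (\int[spectral_mu E (f + 'i%C ^+ k *: h)%R]_x (phi x)%:E))%:C.

(* The selfadjoint operator \int phi dE: the domain is dense, hence the value g is
   determined by its inner products with elements of the domain. *)
Definition spectral_integral E (phi : R -> R) : operator :=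
  [set p | spectral_dom E phi p.1 /\
    forall h, spectral_dom E phi h -> dotp p.2 h = spectral_form E phi p.1 h].

(* The spectral measure of the selfadjoint operator A (unique on Borel sets by
   the spectral theorem). *)
Definition spectral_measure_of A : set R -> H -> H :=
  xget (fun _ _ => 0)
    [set E | spectral_measure E /\ A = spectral_integral E id].

(* A^t for a positive selfadjoint operator A and t > 0; the spectral measure
   of such an operator is carried by [0, +oo[. *)
Definition opow A (t : R) : operator :=
  spectral_integral (spectral_measure_of A) (fun x => x `^ t).

Definition oabs T : operator := opow (adjoint T \; T)%relation 2^-1.

Definition partial_isometry (U : H -> H) : Prop :=
  [/\ linear U, continuous U
    & forall f, (forall g, U g = 0 -> dotp f g = 0) -> `|U f| = `|f|].

Definition ograph (U : H -> H) : operator := [set p | p.2 = U p.1].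

(* For T closed and densely defined, exactly one U satisfies the conditions. *)
Definition polar_factor T : H -> H :=
  xget (fun=> 0)
    [set U | [/\ partial_isometry U, [set f | U f = 0] = okernel T
               & T = (ograph U \; oabs T)%relation]].

Definition aluthge (t : R) T : operator :=
  (opow (oabs T) t \; (ograph (polar_factor T) \; opow (oabs T) (1 - t)))%relation.

End Operators.

Definition vsupp (v : int -> int) : set int := [set n | v n != 0].
Definition vdom (v : int -> int) : set int := [set n | -1 < v n].

(* On the set V below, the infimum and the supremum are attained, so that the
   default values are irrelevant. *)
Definition vm (v : int -> int) : int := infimum 0 (vsupp v) - 2.
Definition vM (v : int -> int) : int := supremum 0 (vdom v).

Definition V : set (int -> int) :=
  [set v | [/\ forall n, -1 <= v n, has_lbound (vsupp v), has_ubound (vdom v)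
             & forall n, n <= vM v -> -1 < v n]].

Definition edge (u v : V) : Prop :=
  vM (\val v) = vM (\val u) + 1 /\
  forall n, n <= vM (\val u) -> \val u n = \val v n.

Definition Chi (u : V) : set V := [set v | edge u v].

Definition par (v : V) : V := xget v [set u | edge u v].

Section WeightedShift.
Variable R : realType.

(* The exponent is v_{m(v)} + ... + v_{M(v)-1}. *)
Definition lambda (w : V) : R :=
  let v := \val w in
  2 ^ (\sum_(0 <= k < `|vM v - vm v|%N) v (vm v + k%:Z)) / (v (vM v) + 1)%:~R.

Definition weighted_shift :=
  [set p : ell2 R V * ell2 R V |
    (\esum_(u in [set: V]) ((\esum_(v in Chi u) (lambda v ^+ 2)%:E)
       * (sqmod (p.1 u))%:E) < +oo)%E /\
    forall v, p.2 v = (lambda v)%:C * p.1 (par v)].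

End WeightedShift.

Arguments weighted_shift R : clear implicits.

(* Main.v *)
From HB Require Import structures.
From mathcomp Require Import all_boot all_order all_algebra.
From mathcomp Require Import all_classical all_reals all_analysis.
From mathcomp Require Import complex.
From mathcomp Require Import ring lra measurable_realfun zify.
Require Import Defs.
Set Implicit Arguments.
Unset Strict Implicit.
Unset Printing Implicit Defensive.
Import Order.TTheory GRing.Theory Num.Theory.
Import numFieldNormedType.Exports.
Local Open Scope classical_set_scope.
Local Open Scope complex_scope.
Local Open Scope ring_scope.

(** The adjoint T of the weighted shift is explicit. For a vertex u let s(u) be the
    sum of its nonnegative entries. The children of u are the sequences uk obtained
    by appending k = 0, 1, 2, ..., and the weight of uk is 2^s(u) / (k + 1). Let
    kappa be the norm of the sequence (1 / (k + 1))_k, and let g_u be the unit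
    vector carried by the children of u with value 1 / ((k + 1) kappa) at uk. The
    shift maps the basis vector e_u to theta_u g_u with theta_u = kappa 2^s(u).
    With G the isometry e_u |-> g_u and D the multiplication by theta, the shift is
    G D, so that T = D G', |T| = G D G' and T = G' |T|, where G' is the adjoint of G
    ([adjoint_level_shift], [oabs_adjoint], [polar_decomposition]).

    Let w be the parent of u = wk. The right factor |T|^(1-t) multiplies g_u by
    theta_u^(1-t), the polar factor turns g_u into e_u, and |T|^t only sees the
    component of e_u along g_w, which is g_w / ((k + 1) kappa). Hence the Aluthge
    transform maps g_u to c_k g_w ([aluthge_fiber_vec]) with
    c_k = 2^s(w) (2^(1-t))^k / (k + 1), which is unbounded in k as t < 1. The
    vectors g_wk / c_k have 0 as a limit point while all their images are g_w, so
    the transform is not closable ([aluthge_not_closable]).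

    The work lies in the fractional powers, defined through an unspecified spectral
    measure of the operator. All the operators at hand are diagonal for one
    sequence of projections P_n: the projection onto the kernel of T, and those
    onto the spans of the g_u with s(u) = n. Such a sequence, with any choice of
    real numbers a_n, carries a spectral measure with atoms P_n at a_n, whose
    spectral integrals are diagonal again ([atomic_spectral_measure],
    [spectral_integral_diag]). Any other spectral measure of the same operator
    agrees with it on Borel sets, since it must put each eigenvector at its eigenvalue
    ([spectral_eigen]). Therefore real powers are taken on the diagonal
    ([opow_diag]). *)

(** * Unordered sums *)

Section RealSums.
Variables (R : realType) (I : choiceType).
Implicit Types (a b p q : I -> R).

Definition abs_summable a := (\esum_(i in [set: I]) `|a i|%:E < +oo)%E.

Lemma abs_summable_le a b : (forall i, `|a i| <= `|b i|) ->
  abs_summable b -> abs_summable a.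
Proof.
by move=> ab; apply: le_lt_trans; apply: le_esum => i _; rewrite lee_fin.
Qed.

Lemma abs_summableD a b : abs_summable a -> abs_summable b ->
  abs_summable (fun i => a i + b i).
Proof.
move=> sa sb; apply: le_lt_trans (lte_add_pinfty sa sb).
by rewrite -esumD// ?le_esum// => i _; rewrite lee_fin// ler_normD.
Qed.

Lemma esumZr (c : R) (a : I -> \bar R) : 0 <= c -> (forall i, 0 <= a i)%E ->
  \esum_(i in [set: I]) (c%:E * a i)%E = (c%:E * \esum_(i in [set: I]) a i)%E.
Proof.
move=> + a0; rewrite le_eqVlt => /predU1P[<-|c0].
  by rewrite mul0e esum1 // => i _; rewrite mul0e.
rewrite /esum -ereal_sup_pZl //.
congr ereal_sup; rewrite image_comp; apply: eq_imagel => A [finA _] /=.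
by rewrite !fsbig_finite //= ge0_sume_distrr.
Qed.

Lemma abs_summableZ (c : R) a : abs_summable a -> abs_summable (fun i => c * a i).
Proof.
move=> sa; rewrite /abs_summable; under eq_esum do rewrite normrM EFinM.
by rewrite esumZr// lte_mul_pinfty// lee_fin.
Qed.

Lemma abs_summableN a : abs_summable a -> abs_summable (fun i => - a i).
Proof. by apply: abs_summable_le => i; rewrite normrN. Qed.

Lemma esum_fin_num a : (forall i, 0 <= a i) -> abs_summable a ->
  (\esum_(i in [set: I]) (a i)%:E \is a fin_num)%E.
Proof.
move=> a0 sa; rewrite ge0_fin_numE; last by apply: esum_ge0 => i _; rewrite lee_fin.
by move: sa; rewrite /abs_summable; under eq_esum do rewrite ger0_norm//.
Qed.

(** Any decomposition of a family into two nonnegative summable parts computes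
    its unordered sum: this is where additivity comes from. *)
Lemma rsumB p q : (forall i, 0 <= p i) -> (forall i, 0 <= q i) ->
    abs_summable p -> abs_summable q ->
  rsum (fun i => p i - q i) = fine (\esum_(i in [set: I]) (p i)%:E)
    - fine (\esum_(i in [set: I]) (q i)%:E).
Proof.
move=> p0 q0 sp sq.
have s_pq : abs_summable (fun i => p i - q i).
  by apply: abs_summableD => //; exact: abs_summableN.
rewrite /rsum.
have maxge0 (x : R) : 0 <= Num.max x 0 by rewrite le_max lexx orbT.
have maxle (x : R) : `|Num.max x 0| <= `|x|.
  by case: (leP x 0) => x0; rewrite ?normr0// normr_ge0.
have fp : (\esum_(i in [set: I]) (Num.max (p i - q i) 0)%:E \is a fin_num)%E.
  by apply: esum_fin_num => //; apply: abs_summable_le s_pq => i.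
have fn : (\esum_(i in [set: I]) (Num.max (- (p i - q i)) 0)%:E \is a fin_num)%E.
  apply: esum_fin_num => //; apply: abs_summable_le s_pq => i.
  by rewrite -[leRHS]normrN.
rewrite -fineB// -fineB ?esum_fin_num//; apply: congr1.
rewrite -(@esumB _ _ [set: I] (EFin \o p) (EFin \o q))//; last 2 first.
- by move=> i _; rewrite lee_fin.
- by move=> i _; rewrite lee_fin.
by congr (_ - _)%E; apply: eq_esum => i _;
  rewrite (funeposE, funenegE) EFin_max ?EFinN.
Qed.

Lemma rsum_ge0 a : (forall i, 0 <= a i) -> abs_summable a ->
  rsum a = fine (\esum_(i in [set: I]) (a i)%:E).
Proof.
move=> a0 sa; transitivity (rsum (fun i => a i - 0)).
  by congr rsum; apply/funext => i; rewrite subr0.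
have s0 : abs_summable (fun=> 0 : R).
  by rewrite /abs_summable esum1 ?ltry// => i _; rewrite normr0.
by rewrite rsumB// [X in _ - fine X]esum1// subr0.
Qed.

Let pos a i := Num.max (a i) 0.
Let neg a i := Num.max (- a i) 0.

Let pos_ge0 a i : 0 <= pos a i.
Proof. by rewrite /pos le_max lexx orbT. Qed.

Let neg_ge0 a i : 0 <= neg a i.
Proof. by rewrite /neg le_max lexx orbT. Qed.

Let posneg a i : a i = pos a i - neg a i.
Proof.
rewrite /pos /neg; have [a0|a0] := leP (a i) 0.
  by rewrite max_l ?oppr_ge0// opprK add0r.
by rewrite max_r ?subr0// oppr_le0 ltW.
Qed.

Let s_pos a : abs_summable a -> abs_summable (pos a).
Proof.
apply: abs_summable_le => i; rewrite /pos.
by case: (leP (a i) 0) => ?; rewrite ?normr0 ?normr_ge0.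
Qed.

Let s_neg a : abs_summable a -> abs_summable (neg a).
Proof.
apply: abs_summable_le => i; rewrite /neg -[leRHS]normrN.
by case: (leP (- a i) 0) => ?; rewrite ?normr0 ?normr_ge0.
Qed.

Lemma rsumN a : rsum (fun i => - a i) = - rsum a.
Proof. by rewrite /rsum opprB; under [in X in _ - X]eq_esum do rewrite opprK. Qed.

Lemma rsumD a b : abs_summable a -> abs_summable b ->
  rsum (fun i => a i + b i) = rsum a + rsum b.
Proof.
move=> sa sb.
have -> : (fun i => a i + b i) =
    (fun i => (pos a i + pos b i) - (neg a i + neg b i)).
  by apply/funext => i; rewrite {1}(posneg a) {1}(posneg b); ring.
rewrite rsumB; last 4 first.
- by move=> i; rewrite addr_ge0.
- by move=> i; rewrite addr_ge0.
- by apply: abs_summableD; exact: s_pos.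
- by apply: abs_summableD; exact: s_neg.
under eq_esum do rewrite EFinD.
under [in X in _ - X]eq_esum do rewrite EFinD.
rewrite !esumD; try by move=> i _; rewrite lee_fin.
rewrite !fineD ?esum_fin_num//; try exact: s_pos; try exact: s_neg.
by rewrite /rsum opprD addrACA.
Qed.

Lemma rsumZ c a : abs_summable a -> rsum (fun i => c * a i) = c * rsum a.
Proof.
have pos_case (d : R) : 0 <= d -> abs_summable a ->
    rsum (fun i => d * a i) = d * rsum a.
  move=> d0 sa.
  have -> : (fun i => d * a i) = (fun i => d * pos a i - d * neg a i).
    by apply/funext => i; rewrite {1}(posneg a) mulrBr.
  rewrite rsumB; last 4 first.
  - by move=> i; rewrite mulr_ge0.
  - by move=> i; rewrite mulr_ge0.
  - by apply: abs_summableZ; exact: s_pos.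
  - by apply: abs_summableZ; exact: s_neg.
  under eq_esum do rewrite EFinM.
  under [in X in _ - X]eq_esum do rewrite EFinM.
  rewrite !esumZr//; try by move=> i; rewrite lee_fin.
  rewrite !fineM ?esum_fin_num//; try exact: s_pos; try exact: s_neg.
  by rewrite /= -mulrBr.
move=> sa; have [c0|c0] := leP 0 c; first exact: pos_case.
rewrite -[c]opprK mulNr -pos_case ?oppr_ge0 ?ltW// -rsumN.
by congr rsum; apply/funext => i; rewrite !mulNr opprK.
Qed.

Lemma rsum0 : rsum (fun _ : I => 0 : R) = 0.
Proof.
rewrite rsum_ge0// ?esum1//.
by rewrite /abs_summable esum1 ?ltry// => i _; rewrite normr0.
Qed.

End RealSums.

Section ComplexSums.
Variables (R : realType) (I : choiceType).
Implicit Types (z w : I -> R[i]).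

Lemma sqmodE (z : R[i]) : sqmod z = complex.Re z ^+ 2 + complex.Im z ^+ 2.
Proof. by case: z => a b; rewrite /sqmod /= sqr_sqrtr// addr_ge0 ?sqr_ge0. Qed.

Lemma sqmodC (z : R[i]) : (sqmod z)%:C = z * z^*.
Proof.
rewrite sqmodE; case: z => a b /=.
by apply/eqP; rewrite eq_complex /= ; apply/andP; split; apply/eqP; ring.
Qed.

Lemma sqmod0 : sqmod (0 : R[i]) = 0.
Proof. by rewrite sqmodE /= expr0n addr0. Qed.

Lemma sqmod_real (a : R) : sqmod a%:C = a ^+ 2.
Proof. by rewrite sqmodE /= expr0n addr0. Qed.

Lemma sqmod_conj (z : R[i]) : sqmod z^* = sqmod z.
Proof. by rewrite !sqmodE; case: z => a b /=; rewrite sqrrN. Qed.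

Lemma conj_real (r : R) : Num.conj (r%:C) = r%:C :> R[i].
Proof. exact: conjc_real. Qed.

Lemma Re_realM (r : R) (z : R[i]) : complex.Re (r%:C * z) = r * complex.Re z.
Proof. by case: z => x y /=; rewrite mul0r subr0. Qed.

Lemma sqr_im : 'i%C ^+ 2 = - 1 :> R[i].
Proof.
by apply/eqP; rewrite expr2 eq_complex /=; apply/andP; split; apply/eqP; ring.
Qed.

Lemma cube_im : 'i%C ^+ 3 = - 'i%C :> R[i].
Proof. by rewrite exprS sqr_im mulrN1. Qed.

Lemma conjD (x y : R[i]) : (x + y)^* = x^* + y^*.
Proof. exact: rmorphD. Qed.

Lemma conjM (x y : R[i]) : (x * y)^* = x^* * y^*.
Proof. exact: rmorphM. Qed.

Definition csum z : R[i] :=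
  rsum (fun i => complex.Re (z i)) +i* rsum (fun i => complex.Im (z i)).

Definition csummable z :=
  abs_summable (fun i => complex.Re (z i)) /\
  abs_summable (fun i => complex.Im (z i)).

Lemma csumD z w : csummable z -> csummable w ->
  csum (fun i => z i + w i) = csum z + csum w.
Proof.
move=> [zr zi] [wr wi]; apply/eqP; rewrite eq_complex /=.
by rewrite -!rsumD//; apply/andP; split; apply/eqP;
  congr rsum; apply/funext => i; case: (z i) (w i) => [? ?] [? ?].
Qed.

Lemma csumZ (c : R[i]) z : csummable z -> csum (fun i => c * z i) = c * csum z.
Proof.
move=> [zr zi]; case: c => a b.
have arr := abs_summableZ a zr; have ari := abs_summableZ a zi.
have brr := abs_summableZ b zr; have bri := abs_summableZ b zi.
rewrite /csum; apply/eqP; rewrite eq_complex; apply/andP; split; apply/eqP => /=.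
  rewrite -!rsumZ// -rsumN -rsumD//; last exact: abs_summableN.
  by congr rsum; apply/funext => i; case: (z i).
by rewrite -!rsumZ// -rsumD//; congr rsum; apply/funext => i; case: (z i).
Qed.

Lemma csum_conj z : csum (fun i => (z i)^*) = (csum z)^*.
Proof.
apply/eqP; rewrite eq_complex /= -rsumN.
by apply/andP; split; apply/eqP; congr rsum; apply/funext => i; case: (z i).
Qed.

Lemma eq_csum z w : z =1 w -> csum z = csum w.
Proof. by move=> /funext->. Qed.

End ComplexSums.

(** * The inner product *)

Section InnerProduct.
Variables (R : realType) (I : choiceType).
Local Notation H := (ell2 R I).
Implicit Types (f g h : H).
Arguments dotp : simpl never.

Lemma ell2P (x : I -> R[i]) : (sqsum x < +oo)%E -> {f : H | ell2_fun f = x}.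
Proof.
move=> xP; have xin : x \in @ell2_pred R I by apply/asboolP.
by exists (Ell2 xin).
Qed.

Lemma ell2_ext f g : f =1 g -> f = g.
Proof. by move=> fg; apply: val_inj; exact/funext. Qed.

Lemma sqsum_lty f : (sqsum f < +oo)%E.
Proof. by have := sqsum_fin f; rewrite ge0_fin_numE ?sqsum_ge0. Qed.

Lemma dotpE f g : dotp f g = csum (fun i => f i * (g i)^*).
Proof. by []. Qed.

Let absre (z : R[i]) : `|complex.Re z| <= Normc.normc z.
Proof.
case: z => a b /=; rewrite -sqrtr_sqr ler_sqrt ?addr_ge0 ?sqr_ge0//.
by rewrite lerDl sqr_ge0.
Qed.

Let absim (z : R[i]) : `|complex.Im z| <= Normc.normc z.
Proof.
case: z => a b /=; rewrite -sqrtr_sqr ler_sqrt ?addr_ge0 ?sqr_ge0//.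
by rewrite lerDr sqr_ge0.
Qed.

Let normc_mul_le (z w : R[i]) : Normc.normc (z * w^*) <= sqmod z + sqmod w.
Proof.
rewrite Normc.normcM -(sqmod_conj w) /sqmod.
have := sqr_ge0 (Normc.normc z - Normc.normc w^*).
have : 0 <= Normc.normc z ^+ 2 + Normc.normc w^* ^+ 2.
  by rewrite addr_ge0 ?sqr_ge0.
by nra.
Qed.

Lemma csummable_dotp f g : csummable (fun i => f i * (g i)^*).
Proof.
have s : abs_summable (fun i => sqmod (f i) + sqmod (g i)).
  apply: abs_summableD.
    rewrite /abs_summable; under eq_esum do rewrite ger0_norm ?sqmod_ge0//.
    exact: sqsum_lty.
  rewrite /abs_summable; under eq_esum do rewrite ger0_norm ?sqmod_ge0//.
  exact: sqsum_lty.
split; apply: abs_summable_le s => i.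
  rewrite [leRHS]ger0_norm ?addr_ge0 ?sqmod_ge0//.
  exact: le_trans (absre _) (normc_mul_le _ _).
rewrite [leRHS]ger0_norm ?addr_ge0 ?sqmod_ge0//.
exact: le_trans (absim _) (normc_mul_le _ _).
Qed.

Lemma dotpDl f g h : dotp (f + g) h = dotp f h + dotp g h.
Proof.
rewrite !dotpE -csumD; [|exact: csummable_dotp|exact: csummable_dotp].
by apply: eq_csum => i; rewrite -mulrDl.
Qed.

Lemma dotpZl a f g : dotp (a *: f) g = a * dotp f g.
Proof.
rewrite !dotpE -csumZ; last exact: csummable_dotp.
by apply: eq_csum => i; rewrite mulrA.
Qed.

Lemma dotpC f g : dotp g f = (dotp f g)^*.
Proof.
rewrite !dotpE -csum_conj; apply: eq_csum => i.
by rewrite conjM conjCK mulrC.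
Qed.

Lemma dotpDr f g h : dotp f (g + h) = dotp f g + dotp f h.
Proof. by rewrite dotpC dotpDl conjD -!dotpC. Qed.

Lemma dotpZr a f g : dotp f (a *: g) = a^* * dotp f g.
Proof. by rewrite dotpC dotpZl conjM -dotpC. Qed.

Lemma dotpNl f g : dotp (- f) g = - dotp f g.
Proof. by rewrite -scaleN1r dotpZl mulN1r. Qed.

Lemma dotpNr f g : dotp f (- g) = - dotp f g.
Proof. by rewrite -scaleN1r dotpZr rmorphN1 mulN1r. Qed.

Lemma dotpBl f g h : dotp (f - g) h = dotp f h - dotp g h.
Proof. by rewrite dotpDl dotpNl. Qed.

Lemma dotpBr f g h : dotp f (g - h) = dotp f g - dotp f h.
Proof. by rewrite dotpDr dotpNr. Qed.

Lemma dotp0l f : dotp 0 f = 0.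
Proof. by rewrite -[X in dotp X _](scale0r (0 : H)) dotpZl mul0r. Qed.

Lemma dotp0r f : dotp f 0 = 0.
Proof. by rewrite dotpC dotp0l conjC0. Qed.

Definition nsq f : R := fine (sqsum f).

Lemma nsqE f : (nsq f)%:E = sqsum f.
Proof. by rewrite fineK// sqsum_fin. Qed.

Lemma nsq_ge0 f : 0 <= nsq f.
Proof. by rewrite fine_ge0// sqsum_ge0. Qed.

Lemma dotpp f : dotp f f = (nsq f)%:C.
Proof.
apply/eqP; rewrite eq_complex /=; apply/andP; split; apply/eqP.
  rewrite rsum_ge0.
  - by congr fine; apply: eq_esum => i _; rewrite -sqmodC.
  - by move=> i; rewrite -sqmodC /= sqmod_ge0.
  - by case: (csummable_dotp f f).
by rewrite -[RHS](rsum0 R I); congr rsum; apply/funext => i; rewrite -sqmodC.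
Qed.

Lemma normE f : `|f| = (Num.sqrt (nsq f))%:C.
Proof. by []. Qed.

Lemma nsq_eq0 f : nsq f = 0 -> f = 0.
Proof. by move=> f0; apply: norm2_eq0; rewrite /norm2 -/(nsq f) f0 sqrtr0. Qed.

Lemma nsqZ a f : nsq (a *: f) = sqmod a * nsq f.
Proof.
apply: EFin_inj; rewrite nsqE EFinM nsqE.
exact: sqsumZ.
Qed.

Lemma nsq0 : nsq 0 = 0.
Proof. by apply: complexI; rewrite -dotpp dotp0l. Qed.

Lemma nsqN f : nsq (- f) = nsq f.
Proof. by apply: complexI; rewrite -!dotpp dotpNl dotpNr opprK. Qed.

(** Every polarization argument goes through this expansion. *)
Lemma nsqDZ c f g :
  nsq (f + c *: g) = nsq f + sqmod c * nsq g + 2 * complex.Re (c^* * dotp f g).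
Proof.
apply: complexI; rewrite -dotpp dotpDl !dotpDr !dotpZl !dotpZr (dotpC f g) !dotpp.
rewrite sqmodE; case: (dotp f g) c => [x y] [a b] /=.
by apply/eqP; rewrite eq_complex /=; apply/andP; split; apply/eqP; ring.
Qed.

Lemma nsqD f g : nsq (f + g) = nsq f + nsq g + 2 * complex.Re (dotp f g).
Proof.
by rewrite -[g in LHS]scale1r nsqDZ conjC1 mul1r (sqmod_real 1) expr1n mul1r.
Qed.

Lemma nsqB f g : nsq (f - g) = nsq f + nsq g - 2 * complex.Re (dotp f g).
Proof. by rewrite nsqD nsqN dotpNr raddfN mulrN. Qed.

Lemma dotp_inj f g : (forall h, dotp f h = dotp g h) -> f = g.
Proof.
move=> fg; apply/eqP; rewrite -subr_eq0; apply/eqP/nsq_eq0/complexI.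
by rewrite -dotpp dotpBl fg subrr.
Qed.

Lemma cauchy_schwarz f g : sqmod (dotp f g) <= nsq f * nsq g.
Proof.
have [g0|g0] := eqVneq (nsq g) 0.
  by rewrite (nsq_eq0 g0) dotp0r sqmod0 nsq0 mulr0.
have gp : 0 < nsq g by rewrite lt_neqAle eq_sym g0 nsq_ge0.
(* This multiple of g is the one that minimizes the norm. *)
have := nsq_ge0 (f + (- dotp f g / (nsq g)%:C) *: g).
rewrite nsqDZ sqmodE; case: (dotp f g) => x y /=.
rewrite !(expr0n, mul0r, mulr0, addr0, subr0, oppr0, sub0r, add0r).
set n := nsq g in gp *; have -> : n / n ^+ 2 = n^-1 by field.
rewrite (_ : nsq f + _ + _ = (nsq f * n - (x ^+ 2 + y ^+ 2)) / n); last first.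
  by field.
by rewrite pmulr_lge0 ?invr_gt0// subr_ge0 sqmodE.
Qed.

Lemma Re_dotp_le f g : complex.Re (dotp f g) ^+ 2 <= nsq f * nsq g.
Proof.
by apply: le_trans (cauchy_schwarz f g); rewrite sqmodE lerDl sqr_ge0.
Qed.

End InnerProduct.

(** * Spectral measures *)

Section Ell2Topology.
Variables (R : realType) (I : choiceType).
Local Notation H := (ell2 R I).

Lemma norm_ltE (f : H) (e : R) : 0 < e -> (`|f| < e%:C) = (nsq f < e ^+ 2).
Proof.
move=> e0; rewrite normE ltcR -[RHS]ltr_sqrt ?exprn_gt0//.
by rewrite sqrtr_sqr ger0_norm// ltW.
Qed.

Lemma gt0_complexE (e : R[i]) : 0 < e -> exists2 r : R, 0 < r & e = r%:C.
Proof.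
case: e => a b; rewrite ltcE /= => /andP[/eqP-> a0]; by exists a.
Qed.

(** Norms are complex numbers here; the real squared norm is the quantity that
    Parseval sums and measures compute. *)
Lemma cvg_nsqP (x : nat -> H) (l : H) :
  x n @[n --> \oo] --> l <->
  forall e : R, 0 < e -> \forall n \near \oo, nsq (l - x n) < e.
Proof.
split=> [xl e e0|xl].
  have se : 0 < Num.sqrt e by rewrite sqrtr_gt0.
  have : 0 < (Num.sqrt e)%:C by rewrite ltcR.
  move/cvgrPdist_lt : xl => /[apply]; apply: filterS => n.
  by rewrite norm_ltE// sqr_sqrtr// ltW.
apply/cvgrPdist_lt => _ /gt0_complexE[r r0 ->].
have := xl _ (exprn_gt0 2 r0); apply: filterS => n.
by rewrite norm_ltE.
Qed.

Lemma cvg_Re_dotp (x : nat -> H) (l f : H) : x n @[n --> \oo] --> l ->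
  complex.Re (dotp (x n) f) @[n --> \oo] --> complex.Re (dotp l f).
Proof.
move=> xl; apply/cvgrPdist_lt => e e0.
have f1 : 0 < nsq f + 1 by rewrite ltr_wpDl ?nsq_ge0.
have ef : 0 < e ^+ 2 / (nsq f + 1) by rewrite divr_gt0 ?exprn_gt0.
move/cvg_nsqP : xl => /(_ _ ef); apply: filterS => n nlt.
rewrite -raddfB -dotpBl -(@ltr_pXn2r _ 2)// ?nnegrE ?normr_ge0 ?ltW//.
rewrite real_normK ?num_real//; apply: le_lt_trans (Re_dotp_le _ _) _.
move: nlt; rewrite ltr_pdivlMr// => nlt.
apply: le_lt_trans nlt; rewrite ler_wpM2l ?nsq_ge0//.
by rewrite lerDl.
Qed.

End Ell2Topology.

Section SpectralMeasures.
Variables (R : realType) (I : choiceType).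
Local Notation H := (ell2 R I).
Variables (E : set R -> H -> H) (HE : spectral_measure E).
Implicit Types (f g h : H) (B X Y : set R).

Lemma spectral_lin B : measurable B -> linear (E B).
Proof. by case: HE => + _ _ => /[apply] -[]. Qed.

Lemma spectral_idem B f : measurable B -> E B (E B f) = E B f.
Proof. by case: HE => + _ _ => /[apply] -[]. Qed.

Lemma spectral_sym B f g : measurable B -> dotp (E B f) g = dotp f (E B g).
Proof. by case: HE => + _ _ => /[apply] -[]. Qed.

Lemma spectral_setT f : E setT f = f.
Proof. by case: HE. Qed.

Lemma spectralD B f g : measurable B -> E B (f + g) = E B f + E B g.
Proof. by move=> mB; have := spectral_lin mB 1 f g; rewrite !scale1r. Qed.

Lemma spectral_0 B : measurable B -> E B 0 = 0.
Proof.
by move=> mB; have := spectralD 0 0 mB; rewrite addr0 -[LHS]addr0 => /addrI<-.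
Qed.

Lemma spectralZ B c f : measurable B -> E B (c *: f) = c *: E B f.
Proof.
by move=> mB; have := spectral_lin mB c f 0; rewrite !addr0 spectral_0// addr0.
Qed.

(** The series all of whose terms are E(0) f converges, so its general term
    vanishes. *)
Lemma spectral_set0 f : E set0 f = 0.
Proof.
have tr : trivIset [set: nat] (fun=> set0 : set R).
  by apply/trivIsetP => *; rewrite set0I.
case: HE => _ _ /(_ _ (fun=> measurable0) tr f); rewrite bigcup0// => cv.
have /cvg_nsqP cv2 := cv.
apply: nsq_eq0; apply/eqP; rewrite eq_le nsq_ge0 andbT.
apply/ler_addgt0Pl => e e0; rewrite addr0.
have [n _ nlt] := cv2 (e / 4) ltac:(by rewrite divr_gt0).
have := nlt n (leqnn n); have := nlt n.+1 (leqnSn n).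
rewrite big_ord_recr /=; set S := \sum_(_ < n) _; set x := E set0 f => h1 h2.
have -> : x = (x - S) - (x - (S + x)).
  by rewrite opprB addrC addrA subrK addrC addKr.
move: (x - S) (x - (S + x)) h1 h2 => a b h1 h2.
by have := nsq_ge0 (a + b); rewrite nsqD nsqB; lra.
Qed.

Lemma spectralU X Y f : measurable X -> measurable Y -> X `&` Y = set0 ->
  E (X `|` Y) f = E X f + E Y f.
Proof.
move=> mX mY XY; pose F := bigcup2 X Y.
have mF n : measurable (F n) by rewrite /F /bigcup2; case: n => [|[|n]] /=.
have tF : trivIset [set: nat] F.
  by apply/trivIsetP => -[|[|i]] [|[|j]] //= _ _ _;
    rewrite /F /bigcup2 /= ?set0I ?setI0// setIC.
case: HE => _ _ /(_ F mF tF f); rewrite -bigcup2E => /cvg_nsqP cv.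
apply/eqP; rewrite -subr_eq0; apply/eqP/nsq_eq0/eqP.
rewrite eq_le nsq_ge0 andbT; apply/ler_addgt0Pl => e e0; rewrite addr0.
have [n _ nlt] := cv e e0; have := nlt n.+2 (leq_addl 2 n).
rewrite -addn2 addnC big_split_ord /= !big_ord_recl big_ord0 addr0 /=.
rewrite [X in _ + _ + X]big1 ?addr0; last by move=> i _; rewrite /F/= spectral_set0.
exact: ltW.
Qed.

Lemma dotp_spectral B f : measurable B -> dotp (E B f) f = (nsq (E B f))%:C.
Proof. by move=> mB; rewrite -dotpp -[RHS]spectral_sym// spectral_idem. Qed.

Lemma nsq_spectral_le B f : measurable B -> nsq (E B f) <= nsq f.
Proof.
move=> mB; rewrite -subr_ge0; have := nsq_ge0 (f - E B f).
by rewrite nsqB dotpC dotp_spectral//=; lra.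
Qed.

(** With g = E(Y) f one has <E(X u Y) g, g> = |E(X) g|^2 + |g|^2, while a
    projection is a contraction. *)
Lemma spectral_disjoint X Y f : measurable X -> measurable Y ->
  X `&` Y = set0 -> E X (E Y f) = 0.
Proof.
move=> mX mY XY; set g := E Y f.
have mXY := measurableU _ _ mX mY.
have := nsq_spectral_le g mXY.
have : dotp (E (X `|` Y) g) g = (nsq (E X g) + nsq g)%:C.
  by rewrite spectralU// dotpDl !dotp_spectral// spectral_idem// rmorphD.
rewrite dotp_spectral// => -[->] le; apply: nsq_eq0; apply/eqP.
by rewrite eq_le nsq_ge0 andbT; lra.
Qed.

(** Multiplicativity is not an axiom of a spectral measure: it follows from
    additivity and from the fact that the values are orthogonal projections, by
    splitting X and Y along their intersection. *)
Lemma spectralI X Y f : measurable X -> measurable Y ->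
  E X (E Y f) = E (X `&` Y) f.
Proof.
move=> mX mY; have mI := measurableI _ _ mX mY.
have mYX := measurableD mY mX; have mXY := measurableD mX mY.
have -> : E Y f = E (X `&` Y) f + E (Y `\` X) f.
  rewrite -spectralU//; first by congr (E _ f); rewrite setIC setUIDK.
  by apply/seteqP; split => // x; rewrite /setD /setI /=; tauto.
rewrite spectralD// (spectral_disjoint (Y := Y `\` X))//; last first.
  by apply/seteqP; split => // x; rewrite /setD /setI /=; tauto.
rewrite addr0.
have -> : E X (E (X `&` Y) f) = E (X `&` Y) (E (X `&` Y) f)
                                + E (X `\` Y) (E (X `&` Y) f).
  rewrite -spectralU//; first by congr (E _ _); rewrite setUIDK.
  by apply/seteqP; split => // x; rewrite /setD /setI /=; tauto.
rewrite spectral_idem// spectral_disjoint ?addr0//.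
by apply/seteqP; split => // x; rewrite /setD /setI /=; tauto.
Qed.

End SpectralMeasures.

Import HBNNSimple.

(** The integral is defined for arbitrary set functions, but only the values on
    measurable sets matter. *)
Lemma eq_setfun_integral d (T : measurableType d) (R : realType)
    (mu nu : set T -> \bar R) (D : set T) (phi : T -> \bar R) :
  (forall B, measurable B -> mu B = nu B) ->
  (\int[mu]_(x in D) phi x = \int[nu]_(x in D) phi x)%E.
Proof.
move=> munu; rewrite /integral.
by congr (ereal_sup _ - ereal_sup _)%E; apply: eq_imagel => h _;
  rewrite !sintegralET; apply: eq_fsbigr => x _; rewrite munu.
Qed.

Lemma integral_mscale d (T : measurableType d) (R : realType)
    (mu : {measure set T -> \bar R}) (D : set T) (mD : measurable D)
    (k : {nonneg R}) (phi : T -> \bar R) : mu.-integrable D phi ->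
  (\int[mscale k mu]_(x in D) phi x = k%:num%:E * \int[mu]_(x in D) phi x)%E.
Proof.
move=> iphi; have mphi := measurable_int _ iphi.
rewrite [LHS]integralE ge0_integral_mscale//; last exact: measurable_funepos.
rewrite ge0_integral_mscale//; last exact: measurable_funeneg.
rewrite -muleBr//; first by rewrite -integralE.
by apply: fin_num_adde_defr; exact: integrable_pos_fin_num.
Qed.

Section SpectralMeasureAsMeasure.
Variables (R : realType) (I : choiceType).
Local Notation H := (ell2 R I).
Variables (E : set R -> H -> H) (HE : spectral_measure E) (f : H).

Lemma spectral_muE (B : set R) : measurable B ->
  spectral_mu E f B = (nsq (E B f))%:E.
Proof. by move=> mB; rewrite /spectral_mu dotp_spectral. Qed.

(** The measure <E(.) f, f>, set to 0 on the sets that are not Borel, where a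
    spectral measure is unconstrained. *)
Definition spectral_meas (_ : spectral_measure E) (B : set R) : \bar R :=
  if `[< measurable B >] then spectral_mu E f B else 0%E.

Lemma spectral_measE (B : set R) : measurable B ->
  spectral_meas HE B = (nsq (E B f))%:E.
Proof. by move=> mB; rewrite /spectral_meas asboolT// spectral_muE. Qed.

Let meas0 : spectral_meas HE set0 = 0%E.
Proof. by rewrite spectral_measE// (spectral_set0 HE) nsq0. Qed.

Let meas_ge0 B : (0 <= spectral_meas HE B)%E.
Proof.
rewrite /spectral_meas; case: asboolP => // mB.
by rewrite spectral_muE// lee_fin nsq_ge0.
Qed.

Let meas_sigma_additive : semi_sigma_additive (spectral_meas HE).
Proof.
move=> F mF tF mUF; rewrite [X in _ --> X]/spectral_meas asboolT//.
rewrite (_ : (fun _ => _) =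
    (fun n => (complex.Re (dotp (\sum_(k < n) E (F k) f) f))%:E)).
  apply: cvg_EFin; first by near=> n.
  by case: HE => _ _ /(_ F mF tF f) /cvg_Re_dotp; exact.
apply/funext => n; rewrite big_mkord.
elim: n => [|n ih]; first by rewrite !big_ord0 dotp0l.
rewrite big_ord_recr [in RHS]big_ord_recr ih dotpDl raddfD EFinD.
by congr (_ + _)%E; rewrite /spectral_meas asboolT.
Unshelve. all: by end_near.
Qed.

HB.instance Definition _ := isMeasure.Build _ _ _ (spectral_meas HE)
  meas0 meas_ge0 meas_sigma_additive.

Let meas_fin : fin_num_fun (spectral_meas HE).
Proof. by move=> B mB; rewrite spectral_measE. Qed.

HB.instance Definition _ := Measure_isFinite.Build _ _ _ (spectral_meas HE)
  meas_fin.

Lemma integral_spectral_mu (D : set R) (phi : R -> \bar R) :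
  (\int[spectral_mu E f]_(x in D) phi x =
   \int[spectral_meas HE]_(x in D) phi x)%E.
Proof.
by apply: eq_setfun_integral => B mB; rewrite spectral_measE// spectral_muE.
Qed.

End SpectralMeasureAsMeasure.

(** * Eigenvectors of spectral integrals *)

Section Eigenvectors.
Variables (R : realType) (I : choiceType).
Local Notation H := (ell2 R I).
Variables (E : set R -> H -> H) (HE : spectral_measure E).
Implicit Types (f g h : H) (X : set R).
Local Notation mu f := (spectral_meas f HE).

Lemma spectral_meas_mixl X c f B : measurable X -> measurable B -> B `<=` X ->
  mu (f + c *: E X f) B = ((sqmod (1 + c))%:E * mu f B)%E.
Proof.
move=> mX mB BX; rewrite !spectral_measE// -EFinM -nsqZ.
rewrite (spectralD HE)// (spectralZ HE)// (spectralI HE)// setIidl//.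
by rewrite scalerDl scale1r.
Qed.

Lemma spectral_meas_mixr X c f B : measurable X -> measurable B -> B `<=` ~` X ->
  mu (f + c *: E X f) B = mu f B.
Proof.
move=> mX mB BX; rewrite !spectral_measE//.
rewrite (spectralD HE)// (spectralZ HE)// (spectralI HE)//.
rewrite (_ : B `&` X = set0) ?(spectral_set0 HE) ?scaler0 ?addr0//.
by apply/disjoints_subset.
Qed.

Let nng (c : R[i]) : {nonneg R} := NngNum (sqmod_ge0 (1 + c)).

(** Spectrally, f + c E(X) f is (1 + c) f inside X and f outside. *)
Lemma integral_mix X c f (phi : R -> \bar R) : measurable X ->
    (mu f).-integrable setT phi ->
  (\int[mu (f + c *: E X f)%R]_x phi x =
   (sqmod (1 + c)%R)%:E * \int[mu f]_(x in X) phi x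
   + \int[mu f]_(x in ~` X) phi x)%E.
Proof.
move=> mX iphi; have mCX := measurableC mX.
rewrite -(setUv X) integral_setU//; last 2 first.
- by rewrite setUv; exact: measurable_int iphi.
- by apply/disj_set2P; rewrite setICr.
congr (_ + _)%E; last first.
  by apply: eq_measure_integral => B mB BX; exact: spectral_meas_mixr.
transitivity (\int[mscale (nng c) (mu f)]_(x in X) phi x)%E.
  by apply: eq_measure_integral => B mB BX; exact: spectral_meas_mixl.
by rewrite integral_mscale//; exact: integrableS iphi.
Qed.

Section Eigenvector.
Variables (f : H) (c : R).
Hypothesis fc : spectral_integral E id (f, c%:C *: f).

Let sq_lty : (\int[mu f]_x (x ^+ 2)%:E < +oo)%E.
Proof. by case: fc => + _; rewrite /spectral_dom/= integral_spectral_mu. Qed.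

Let msq : measurable_fun [set: R] (fun x : R => (x ^+ 2)%:E).
Proof. by apply/measurable_EFinP; exact: measurable_funX. Qed.

Let isq : (mu f).-integrable setT (fun x : R => (x ^+ 2)%:E).
Proof.
apply/integrableP; split => //; rewrite (eq_integral (fun x : R => (x ^+ 2)%:E)) //.
by move=> x _; rewrite gee0_abs// lee_fin sqr_ge0.
Qed.

Let icst (r : R) : (mu f).-integrable setT (EFin \o cst r).
Proof. exact: finite_measure_integrable_cst. Qed.

Let iid : (mu f).-integrable setT (fun x : R => x%:E).
Proof.
apply: le_integrable (integrableD measurableT (icst 1) isq) => //.
  by apply/measurable_EFinP; exact: measurable_id.
move=> x _; rewrite /= lee_fin [leRHS]ger0_norm; last by rewrite addr_ge0// sqr_ge0.
have [x0|x0] := ger0P x; nra.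
Qed.

(** Testing the eigenvalue equation against E(X) f turns it into an identity
    between integrals over X. *)
Lemma eigen_integral X : measurable X ->
  (\int[mu f]_(x in X) x%:E = \int[mu f]_(x in X) c%:E)%E.
Proof.
move=> mX; have mCX := measurableC mX.
have iX : (mu f).-integrable X (fun x : R => x%:E) by exact: integrableS iid.
have iCX : (mu f).-integrable (~` X) (fun x : R => x%:E).
  exact: integrableS iid.
have dX : spectral_dom E id (E X f).
  rewrite /spectral_dom/= integral_spectral_mu.
  (* The case 1 + c = 0 of [integral_mix], for the complement of X. *)
  have -> : E X f = f + (- 1) *: E (~` X) f.
    by rewrite -[X in X + _](spectral_setT HE) -(setUv X) (spectralU HE)// ?setICr//
      scaleN1r addrK.
  rewrite integral_mix// subrr sqmod0 mul0e add0e setCK.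
  by apply: le_lt_trans sq_lty; apply: ge0_subset_integral => // x _;
    rewrite lee_fin sqr_ge0.
set J1 := (\int[_]_(x in X) x%:E)%E.
pose J0 := (\int[mu f]_(x in ~` X) x%:E)%E.
have fJ1 : J1 \is a fin_num by exact: integrable_fin_num.
have fJ0 : J0 \is a fin_num by exact: integrable_fin_num.
have mix (a : R[i]) : fine (\int[spectral_mu E (f + a *: E X f)%R]_x (id x)%:E)%E
    = sqmod (1 + a) * fine J1 + fine J0.
  by rewrite integral_spectral_mu integral_mix// -/J1 -/J0 fineD ?fin_numM// fineM.
case: fc => _ /(_ _ dX); rewrite dotpZl -(spectral_sym HE)// dotp_spectral//.
rewrite /spectral_form (eq_bigr (fun k : 'I_4 => 'i%C ^+ k *
  (sqmod (1 + 'i%C ^+ k) * fine J1 + fine J0)%:C)); last by move=> k _; rewrite mix.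
(* The weights |1 + i^k|^2 are 4, 2, 0, 2 while the sum of the i^k is 0: only
   the integral over X survives, with coefficient 1. *)
rewrite !big_ord_recr big_ord0 /= expr0 expr1 sqr_im cube_im !sqmodE /= integral_cst//.
rewrite (_ : _ X = (nsq (E X f))%:E); last exact: spectral_measE.
rewrite -(fineK fJ1) -EFinM.
move: (fine J1) (fine J0) (nsq _) => j1 j0 n.
case=> h _; congr EFin; rewrite -[RHS]subr0 -[in RHS](mul0r 0) {}h.
by field.
Qed.

(** An eigenvector is carried by its eigenvalue: x and the constant c have the
    same integral over every Borel set, hence agree almost everywhere. This is
    the form of uniqueness of the spectral measure that the powers need. *)
Lemma spectral_eigen X : measurable X -> E X f = (\1_X c)%:C *: f.
Proof.
have mc : measurable (~` [set c] : set R) by exact: measurableC.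
have ae : ae_eq (mu f) setT (fun x : R => x%:E) (cst c%:E).
  by apply: integral_ae_eq => // B _ mB; exact: eigen_integral.
have Ec : E (~` [set c]) f = 0.
  apply: nsq_eq0; apply: EFin_inj; rewrite -(spectral_measE HE)//.
  apply/(negligibleP _ mc); apply: negligibleS ae => x /= xc /(_ Logic.I) [].
  exact: xc.
have out Y : measurable Y -> ~ Y c -> E Y f = 0.
  move=> mY Yc; have -> : Y = Y `&` ~` [set c].
    by apply/esym/setIidPl => y Yy yc; apply: Yc; rewrite -yc.
  by rewrite -(spectralI HE)// Ec (spectral_0 HE).
move=> mX; rewrite indicE; case: (boolP (c \in X)) => cX.
  rewrite scale1r -[RHS](spectral_setT HE) -(setUv X) (spectralU HE) ?setICr//.
    by rewrite [X in _ + X]out ?addr0//; [exact: measurableC|apply; exact: set_mem].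
  exact: measurableC.
by rewrite scale0r out// => /mem_set; exact/negP.
Qed.

End Eigenvector.
End Eigenvectors.

(** * Diagonal operators and their real powers *)

Section Resolution.
Variables (R : realType) (I : choiceType).
Local Notation H := (ell2 R I).
Implicit Types (f g h k : H) (b : nat -> R).

(** A sequence of pairwise orthogonal projections with sum the identity. The last
    field is how completeness of the space enters (Riesz-Fischer): it makes every
    multiplier with square-summable image act. *)
Record resolution (P : nat -> H -> H) : Prop := Resolution {
  res_linear : forall n, linear (P n) ;
  res_sym : forall n f g, dotp (P n f) g = dotp f (P n g) ;
  res_orth : forall m n f, P m (P n f) = if m == n then P n f else 0 ;
  res_parseval : forall f,
    \esum_(n in [set: nat]) (nsq (P n f))%:E = (nsq f)%:E ;
  res_mult : forall b f,
    (\esum_(n in [set: nat]) (b n ^+ 2 * nsq (P n f))%:E < +oo)%E ->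
    exists g, forall n, P n g = (b n)%:C *: P n f }.

Variables (P : nat -> H -> H) (HP : resolution P).

Lemma resD n f g : P n (f + g) = P n f + P n g.
Proof. by have := res_linear HP n 1 f g; rewrite !scale1r. Qed.

Lemma res0 n : P n 0 = 0.
Proof. by have := resD n 0 0; rewrite addr0 -[LHS]addr0 => /addrI<-. Qed.

Lemma resZ n c f : P n (c *: f) = c *: P n f.
Proof. by have := res_linear HP n c f 0; rewrite !addr0 res0 addr0. Qed.

Lemma resB n f g : P n (f - g) = P n f - P n g.
Proof. by rewrite resD -scaleN1r resZ scaleN1r. Qed.

Lemma res_inj f g : (forall n, P n f = P n g) -> f = g.
Proof.
move=> fg; apply/eqP; rewrite -subr_eq0; apply/eqP/nsq_eq0/EFin_inj.
by rewrite -(res_parseval HP) esum1// => n _; rewrite resB fg subrr nsq0.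
Qed.

Lemma res_nsq_ge0 n f : (0 <= (nsq (P n f))%:E)%E.
Proof. by rewrite lee_fin nsq_ge0. Qed.

(** The operator \sum_n b_n P_n with its maximal domain. *)
Definition diag b : set (H * H) :=
  [set p | forall n, P n p.2 = (b n)%:C *: P n p.1].

Lemma diagD b f g h k : diag b (f, g) -> diag b (h, k) -> diag b (f + h, g + k).
Proof. by move=> fg hk n; rewrite /= !resD fg hk scalerDr. Qed.

Lemma diagZ b c f g : diag b (f, g) -> diag b (c *: f, c *: g).
Proof. by move=> fg n; rewrite /= !resZ fg !scalerA mulrC. Qed.

Lemma diag_res b n f : diag b (P n f, (b n)%:C *: P n f).
Proof.
move=> m; rewrite /= resZ !(res_orth HP); case: eqP => [->//|_].
by rewrite !scaler0.
Qed.

Lemma diag_summable b f g : diag b (f, g) ->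
  \esum_(n in [set: nat]) (b n ^+ 2 * nsq (P n f))%:E = (nsq g)%:E.
Proof.
move=> fg; rewrite -(res_parseval HP); apply: eq_esum => n _.
by rewrite fg nsqZ sqmod_real.
Qed.

Let diag_sym_Re b f g h k : diag b (f, g) -> diag b (h, k) ->
  complex.Re (dotp g h) = complex.Re (dotp f k).
Proof.
move=> fg hk.
have : ((nsq (g + h))%:E + (nsq (f - k))%:E
      = (nsq (g - h))%:E + (nsq (f + k))%:E)%E.
  rewrite -!(res_parseval HP) -!esumD//; try by move=> n _; exact: res_nsq_ge0.
  apply: eq_esum => n _; rewrite -!EFinD !resB !resD fg hk /=; congr EFin.
  rewrite !nsqB !nsqD !nsqZ !dotpZl !dotpZr !conj_real !Re_realM.
  by ring.
by rewrite -!EFinD !nsqB !nsqD => e; have := EFin_inj e; lra.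
Qed.

(** Real multipliers are symmetric: the quadratic identity behind this holds
    term by term in the Parseval sums. *)
Lemma diag_sym b f g h k : diag b (f, g) -> diag b (h, k) ->
  dotp g h = dotp f k.
Proof.
move=> fg hk; apply/eqP; rewrite eq_complex; apply/andP; split; apply/eqP.
  exact: diag_sym_Re fg hk.
have := diag_sym_Re (diagZ 'i%C fg) hk; rewrite !dotpZl.
by case: (dotp g h) (dotp f k) => [x y] [z w] /=; lra.
Qed.

Section Atomic.
Variable a : nat -> R.

(** These values are determined, since the P_n separate vectors; they form the
    spectral measure whose atoms P_n sit at the points a_n. *)
Definition atomic_proj (B : set R) f : H :=
  xget 0 [set g | diag (fun n => \1_B (a n)) (f, g)].

Lemma atomic_projP B n f : P n (atomic_proj B f) = (\1_B (a n))%:C *: P n f.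
Proof.
have [g fg] : exists g, diag (fun n => \1_B (a n)) (f, g).
  apply: (res_mult HP (b := fun n => \1_B (a n))).
  apply: le_lt_trans (ltry (nsq f)); rewrite -(res_parseval HP).
  apply: le_esum => m _; rewrite lee_fin indicE ler_piMl ?nsq_ge0//.
  by case: (_ \in _); rewrite ?expr1n ?expr0n.
have ex : [set g | diag (fun n => \1_B (a n)) (f, g)] !=set0 by exists g.
exact: (xgetPex 0 ex).
Qed.

(** The measure \sum_n |P_n f|^2 delta_{a_n}. *)
Definition atomic_meas f : {measure set R -> \bar R} :=
  mseries (fun n => mscale (NngNum (nsq_ge0 (P n f))) (dirac (a n))) 0.

Lemma atomic_measE f (B : set R) : atomic_meas f B =
  \esum_(n in [set: nat]) (\1_B (a n) * nsq (P n f))%:E.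
Proof.
rewrite /atomic_meas /= /mseries nneseries_esumT; last first.
  by move=> n; exact: measure_ge0.
by apply: eq_esum => n _; rewrite mulrC EFinM.
Qed.

Lemma integral_atomic f (phi : R -> R) : measurable_fun setT phi ->
    (forall x, 0 <= phi x) ->
  (\int[atomic_meas f]_x (phi x)%:E)%E =
  \esum_(n in [set: nat]) (phi (a n) * nsq (P n f))%:E.
Proof.
move=> mphi phi0; have mphi' : measurable_fun setT (EFin \o phi).
  exact/measurable_EFinP.
rewrite ge0_integral_measure_series//; last by move=> x _; rewrite lee_fin.
rewrite nneseries_esumT; last first.
  by move=> n; apply: integral_ge0 => x _; rewrite lee_fin.
apply: eq_esum => n _.
rewrite ge0_integral_mscale//; last by move=> x _; rewrite lee_fin.
by rewrite integral_dirac// diracT mul1e mulrC.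
Qed.

Section Integral.
Variable E : set R -> H -> H.
Hypothesis PE : forall B, measurable B -> forall n f,
  P n (E B f) = (\1_B (a n))%:C *: P n f.

Lemma nsq_atomic (B : set R) f : measurable B ->
  (nsq (E B f))%:E = atomic_meas f B.
Proof.
move=> mB; rewrite atomic_measE -(res_parseval HP); apply: eq_esum => n _.
rewrite PE// nsqZ sqmod_real indicE.
by case: (_ \in _); rewrite ?expr1n ?expr0n.
Qed.

End Integral.

(** Countable additivity in norm comes from continuity from below of the scalar
    measures: the n-th partial sum is E(S_n) f for the union S_n of the first n
    sets, and |E(U) f - E(S_n) f|^2 = |E(U) f|^2 - |E(S_n) f|^2. *)
Lemma atomic_spectral_measure : spectral_measure atomic_proj.
Proof.
have PE B n f := atomic_projP B n f.
split=> [B mB|f|F mF tF f].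
- split=> [c f g|f|f g].
  + by apply: res_inj => n; rewrite PE !resD !resZ !PE scalerDr !scalerA mulrC.
  + apply: res_inj => n; rewrite !PE scalerA indicE.
    by case: (_ \in _); rewrite ?mul1r ?mul0r.
  + by apply: (@diag_sym (fun n => \1_B (a n))) => n; rewrite /= PE.
- by apply: res_inj => n; rewrite PE indicE in_setT scale1r.
pose S n := \big[setU/set0]_(k < n) F k.
have mS n : measurable (S n) by exact: bigsetU_measurable.
have mU : measurable (\bigcup_n F n) by exact: bigcup_measurable.
have SE n : \sum_(k < n) atomic_proj (F k) f = atomic_proj (S n) f.
  elim: n => [|n ih]; rewrite /S.
    rewrite !big_ord0; apply: res_inj => m.
    by rewrite PE res0 indicE in_set0 scale0r.
  rewrite !big_ord_recr ih /=; apply: res_inj => m; rewrite resD !PE -scalerDl.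
  rewrite -rmorphD /= -/(S n); congr (_%:C *: _); rewrite !indicE in_setU.
  have [|] := boolP (a m \in S n); last by rewrite add0r.
  rewrite /S -bigcup_mkord inE => -[k /= kn Fka].
  rewrite memNset ?addr0// => Fna.
  move/trivIsetP : tF => /(_ k n Logic.I Logic.I); rewrite (ltn_eqF kn).
  by move=> /(_ isT) k0; suff : set0 (a m) by []; rewrite -k0.
have SU n : S n `<=` \bigcup_n F n.
  by rewrite /S -bigcup_mkord => x [k _ Fkx]; exists k.
have cvS : (atomic_meas f \o S) @ \oo --> atomic_meas f (\bigcup_n F n).
  have -> : \bigcup_n F n = \bigcup_n S n.
    apply/seteqP; split=> [x [k _ Fx]|x [k _ /SU//]].
    by exists k.+1 => //; rewrite /S big_ord_recr; right.
  apply: nondecreasing_cvg_mu => //; first exact: bigcup_measurable.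
  by move=> m n mn; apply/subsetPset; exact: subset_bigsetU.
have nsqS (B : set R) : measurable B ->
    atomic_meas f B = (nsq (atomic_proj B f))%:E.
  by move=> mB; rewrite -(@nsq_atomic atomic_proj).
apply/cvg_nsqP => e e0.
rewrite nsqS// in cvS.
have {}cvS : nsq (atomic_proj (S n) f) @[n --> \oo] -->
    nsq (atomic_proj (\bigcup_n F n) f).
  have -> : (fun n => nsq (atomic_proj (S n) f)) = fine \o (atomic_meas f \o S).
    by apply/funext => n; rewrite /= nsqS.
  by move/fine_cvgP : cvS => [].
move/cvgrPdist_lt : cvS => /(_ e e0); apply: filterS => n; rewrite SE.
set x := atomic_proj _ f; set y := atomic_proj _ f => xy.
have yx : atomic_proj (S n) x = y.
  apply: res_inj => m; rewrite !PE scalerA -rmorphM !indicE.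
  case: (boolP (a m \in S n)); rewrite ?mul0r// => /set_mem /SU /mem_set ->.
  by rewrite mulr1.
have dx : diag (fun m => \1_(S n) (a m)) (x, y) by move=> m; rewrite -yx PE.
have dy : diag (fun m => \1_(S n) (a m)) (y, y).
  move=> m; rewrite /= -yx !(PE (S n)) scalerA -rmorphM indicE.
  by case: (_ \in _); rewrite /= ?mulr1 ?mulr0.
rewrite nsqB -(diag_sym dx dy) dotpp /=; move: xy; apply: le_lt_trans.
by apply: le_trans (ler_norm _); rewrite le_eqVlt; apply/orP; left; apply/eqP; ring.
Unshelve. all: by end_near.
Qed.

Section SpectralIntegral.
Variable E : set R -> H -> H.
Hypothesis HE : spectral_measure E.
Hypothesis PE : forall B, measurable B -> forall n f,
  P n (E B f) = (\1_B (a n))%:C *: P n f.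

Lemma spectral_mu_atomic f (B : set R) : measurable B ->
  spectral_mu E f B = atomic_meas f B.
Proof. by move=> mB; rewrite (spectral_muE HE)// (nsq_atomic PE). Qed.

Lemma integral_spectral_atomic f (phi : R -> \bar R) :
  (\int[spectral_mu E f]_x phi x = \int[atomic_meas f]_x phi x)%E.
Proof. by apply: eq_setfun_integral => B mB; exact: spectral_mu_atomic. Qed.

Variable phi : R -> R.
Hypothesis mphi : measurable_fun setT phi.
Local Notation b := (fun n => phi (a n)).

Lemma spectral_domE f : spectral_dom E phi f =
  (\esum_(n in [set: nat]) (b n ^+ 2 * nsq (P n f))%:E < +oo)%E.
Proof.
rewrite /spectral_dom /= integral_spectral_atomic.
rewrite (integral_atomic _ (phi := fun x => phi x ^+ 2))//.
  exact: measurable_funX.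
by move=> x; exact: sqr_ge0.
Qed.

Lemma diag_spectral_dom f g : diag b (f, g) -> spectral_dom E phi f.
Proof. by move=> fg; rewrite spectral_domE (diag_summable fg) ltry. Qed.

(** Re <g, f> is a quarter of |g + f|^2 - |g - f|^2. The positive and negative
    parts of phi are put on opposite sides of that identity, so that all the
    series have nonnegative terms. *)
Lemma integral_diag f g : diag b (f, g) ->
  fine (\int[spectral_mu E f]_x (phi x)%:E)%E = complex.Re (dotp g f).
Proof.
move=> fg; rewrite integral_spectral_atomic.
pose pp x := Num.max (phi x) 0; pose pn x := Num.max (- phi x) 0.
have ppE x : pp x - pn x = phi x.
  rewrite /pp /pn; have [x0|x0] := leP (phi x) 0.
    by rewrite max_l ?oppr_ge0// opprK add0r.
  by rewrite max_r ?subr0// oppr_le0 ltW.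
have pp0 x : 0 <= pp x by rewrite /pp le_max lexx orbT.
have pn0 x : 0 <= pn x by rewrite /pn le_max lexx orbT.
have mpp : measurable_fun setT pp by exact: measurable_maxr.
have mpn : measurable_fun setT pn.
  by apply: measurable_maxr => //; exact: measurable_funN.
pose w n := nsq (P n f); have w0 n : 0 <= w n by exact: nsq_ge0.
pose S (psi : R -> R) := \esum_(n in [set: nat]) (psi (a n) * w n)%:E.
have finS psi : (forall x, 0 <= psi x) ->
    (forall x, psi x <= 1 + phi x ^+ 2) -> S psi \is a fin_num.
  move=> psi0 psi_le; rewrite ge0_fin_numE; last first.
    by apply: esum_ge0 => n _; rewrite lee_fin; apply: mulr_ge0.
  apply: (@le_lt_trans _ _ (nsq f + nsq g)%:E); last exact: ltry.
  rewrite EFinD -(res_parseval HP) -(diag_summable fg) -esumD; last 2 first.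
  - by move=> n _; rewrite lee_fin nsq_ge0.
  - by move=> n _; rewrite lee_fin mulr_ge0 ?sqr_ge0 ?nsq_ge0.
  apply: le_esum => n _; rewrite -EFinD lee_fin -/(w n) -[X in X + _]mul1r -mulrDl.
  by rewrite ler_wpM2r.
have fpp : S pp \is a fin_num.
  by apply: finS => // x; rewrite /pp ge_max; apply/andP; split; nra.
have fpn : S pn \is a fin_num.
  by apply: finS => // x; rewrite /pn ge_max; apply/andP; split; nra.
rewrite integralE (eq_integral (fun x => (pp x)%:E)); last first.
  by move=> x _; rewrite funeposE /= EFin_max.
rewrite [X in (_ - X)%E](eq_integral (fun x => (pn x)%:E)); last first.
  by move=> x _; rewrite funenegE /= EFin_max EFinN.
rewrite !integral_atomic// -/(S pp) -/(S pn) fineB//.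
have : ((nsq (g + f))%:E + 4%:E * S pn = (nsq (g - f))%:E + 4%:E * S pp)%E.
  rewrite /S -!(res_parseval HP) -!esumZr//; try by
    move=> n; rewrite lee_fin mulr_ge0.
  rewrite -!esumD//; try by move=> n _; rewrite lee_fin ?mulr_ge0 ?nsq_ge0.
  apply: eq_esum => n _; rewrite -!EFinD resB resD fg /=; congr EFin.
  rewrite nsqB nsqD !nsqZ !dotpZl Re_realM dotpp sqmod_real -/(w n) -[in LHS](ppE (a n)).
  rewrite -(ppE (a n)) /=; ring.
rewrite -(fineK fpp) -(fineK fpn) -!EFinM -!EFinD nsqB nsqD => e.
by have := EFin_inj e; lra.
Qed.

(** Polarization: the quadratic form of a symmetric operator determines it. *)
Lemma spectral_form_diag f g h k : diag b (f, g) -> diag b (h, k) ->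
  spectral_form E phi f h = dotp g h.
Proof.
move=> fg hk; rewrite /spectral_form.
have kf : dotp k f = Num.conj (dotp g h) by rewrite (diag_sym fg hk) -dotpC.
pose z := dotp g h; pose r := complex.Re (dotp g f) + complex.Re (dotp k h).
have ReC (c w : R[i]) :
    complex.Re (c * Num.conj w) = complex.Re (Num.conj c * w).
  by case: c w => [x y] [u v] /=; ring.
have quad (c : R[i]) : c * Num.conj c = 1 ->
    fine (\int[spectral_mu E (f + c *: h)%R]_x (phi x)%:E)%E =
    r + 2 * complex.Re (Num.conj c * z).
  move=> cc; rewrite (integral_diag (diagD fg (diagZ c hk))).
  rewrite dotpDl !dotpDr !dotpZl !dotpZr mulrA cc mul1r kf -/z.
  rewrite !raddfD /r.
  have := ReC c z; move: (dotp g f) (dotp k h) (c * _) (Num.conj c * _).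
  by case=> [? ?] [? ?] [? ?] [? ?] /=; lra.
have ii : 'i%C * Num.conj 'i%C = 1 :> R[i].
  by apply/eqP; rewrite eq_complex /=; apply/andP; split; apply/eqP; ring.
rewrite (eq_bigr (fun j : 'I_4 => 'i%C ^+ j *
    (r + 2 * complex.Re (Num.conj ('i%C ^+ j) * z))%:C)); last first.
  by move=> j _; rewrite quad// rmorphXn -exprMn ii expr1n.
rewrite -/z; move: r z {quad} => s [x y].
rewrite !big_ord_recr big_ord0 /= expr0 expr1 sqr_im cube_im.
by apply/eqP; rewrite eq_complex; apply/andP; split; apply/eqP => /=; field.
Qed.

Lemma diag_trunc f : spectral_dom E phi f -> exists g, diag b (f, g).
Proof. by rewrite spectral_domE => /(res_mult HP). Qed.

(** The functional calculus of a spectral measure that is diagonal with respect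
    to (P_n): the inclusion from left to right tests against the vectors P_n k. *)
Lemma spectral_integral_diag : spectral_integral E phi = diag b.
Proof.
apply/seteqP; split=> [[f g] /= [df fg]|[f g] fg].
  have [g' fg'] := diag_trunc df.
  suff -> : g = g' by [].
  apply: res_inj => n; apply: dotp_inj => k; rewrite !(res_sym HP).
  have nk := diag_res b n k.
  by rewrite fg ?(spectral_form_diag fg' nk)//; exact: diag_spectral_dom nk.
split=> /=; first exact: diag_spectral_dom fg.
by move=> h /diag_trunc[k hk]; rewrite (spectral_form_diag fg hk).
Qed.

End SpectralIntegral.

End Atomic.

(** Real powers of a diagonal operator are computed on the diagonal. The
    spectral measure used by [opow] is only known to represent diag b; since it
    maps every eigenvector P_n f to a multiple of itself, it is diagonal too. *)
Lemma opow_diag b t : opow (diag b) t = diag (fun n => b n `^ t).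
Proof.
rewrite /opow /spectral_measure_of.
have bspec : diag b = spectral_integral (atomic_proj b) id.
  rewrite (spectral_integral_diag (a := b))//.
  - exact: atomic_spectral_measure.
  - by move=> B _ n f; exact: atomic_projP.
set Q := [set E | _]; have Q0 : Q !=set0.
  by exists (atomic_proj b); split => //; exact: atomic_spectral_measure.
case: (xgetPex (fun _ _ => 0) Q0); move: (xget _ _) => E HE bE.
have EP B : measurable B -> forall n f, E B (P n f) = (\1_B (b n))%:C *: P n f.
  by move=> mB n f; apply: (spectral_eigen HE) => //; rewrite -bE; exact: diag_res.
apply: (spectral_integral_diag (a := b) HE) => [B mB n f|].
  apply: dotp_inj => h.
  rewrite (res_sym HP) (spectral_sym HE)// EP// dotpZr dotpZl (res_sym HP).
  by rewrite conj_real.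
exact: measurable_powR.
Qed.

End Resolution.

(** * Sums over fibers, and the isometry of a fibration *)

Section Fibers.
Variables (R : realType) (I J : choiceType) (p : I -> J).

Lemma esum_fiber (a : I -> \bar R) : (forall i, 0 <= a i)%E ->
  \esum_(i in [set: I]) a i =
  \esum_(j in [set: J]) \esum_(i in [set: I]) (if p i == j then a i else 0%E).
Proof.
move=> a0; transitivity
    (\esum_(j in [set: J]) \esum_(i in p @^-1` [set j]) a i); last first.
  apply: eq_esum => j _; rewrite esum_mkcond; apply: eq_esum => i _.
  by congr (if _ then _ else _); apply/idP/eqP; rewrite inE.
rewrite esum_esum//.
rewrite (@reindex_esum _ _ _ [set: I] _ (fun i => (p i, i)))//; split => //.
  by move=> i i' _ _ [].
by move=> [j i] [/= _ <-]; exists i.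
Qed.

(** Fubini for the partition into fibers, applied separately to the positive and
    the negative part. *)
Lemma rsum_fiber (a : I -> R) : abs_summable a ->
  rsum a = rsum (fun j => rsum (fun i => if p i == j then a i else 0)).
Proof.
move=> sa; pose F (b : I -> R) j i : R := if p i == j then b i else 0.
pose pos i := Num.max (a i) 0; pose neg i := Num.max (- a i) 0.
have pos0 i : 0 <= pos i by rewrite /pos le_max lexx orbT.
have neg0 i : 0 <= neg i by rewrite /neg le_max lexx orbT.
have spos : abs_summable pos.
  apply: abs_summable_le sa => i; rewrite /pos.
  by case: (leP (a i) 0) => ?; rewrite ?normr0 ?normr_ge0.
have sneg : abs_summable neg.
  apply: abs_summable_le sa => i; rewrite /neg -[leRHS]normrN.
  by case: (leP (- a i) 0) => ?; rewrite ?normr0 ?normr_ge0.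
have fib (b : I -> R) : (forall i, 0 <= b i) -> abs_summable b ->
    exists B : J -> R, [/\ forall j, 0 <= B j, abs_summable B,
      forall j, (B j)%:E = \esum_(i in [set: I]) (F b j i)%:E
      & \esum_(j in [set: J]) (B j)%:E = \esum_(i in [set: I]) (b i)%:E].
  move=> b0 sb; pose B j := fine (\esum_(i in [set: I]) (F b j i)%:E).
  have F0 j i : 0 <= F b j i by rewrite /F; case: ifP.
  have BE j : (B j)%:E = \esum_(i in [set: I]) (F b j i)%:E.
    rewrite fineK// esum_fin_num//; apply: abs_summable_le sb => i.
    by rewrite /F; case: ifP; rewrite ?normr0 ?normr_ge0.
  have B0 j : 0 <= B j by rewrite -lee_fin BE esum_ge0// => i _; rewrite lee_fin.
  have BS : \esum_(j in [set: J]) (B j)%:E = \esum_(i in [set: I]) (b i)%:E.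
    rewrite [RHS]esum_fiber; last by move=> i; rewrite lee_fin.
    apply: eq_esum => j _; rewrite BE; apply: eq_esum => i _.
    by rewrite /F; case: ifP.
  exists B; split => //.
  rewrite /abs_summable (eq_esum (b := fun j => (B j)%:E)); last first.
    by move=> j _; rewrite ger0_norm.
  rewrite BS; move: (esum_fin_num b0 sb); rewrite ge0_fin_numE// esum_ge0// => i _.
  by rewrite lee_fin.
have [B [B0 sB BE BS]] := fib _ pos0 spos.
have [C [C0 sC CE CS]] := fib _ neg0 sneg.
transitivity (rsum (fun j => B j - C j)).
  by rewrite rsumB// BS CS.
congr rsum; apply/funext => j; rewrite /rsum.
have -> : B j = fine (B j)%:E by [].
have -> : C j = fine (C j)%:E by [].
rewrite BE CE; congr (fine _ - fine _); apply: eq_esum => i _;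
  by rewrite /F /pos /neg; case: ifP => //; rewrite ?oppr0 maxxx.
Qed.

Lemma csum_fiber (z : I -> R[i]) : csummable z ->
  csum z = csum (fun j => csum (fun i => if p i == j then z i else 0)).
Proof.
move=> [zr zi]; rewrite /csum (rsum_fiber zr) (rsum_fiber zi) /=.
congr (_ +i* _); congr rsum; apply/funext => j; congr rsum; apply/funext => i;
  by case: ifP.
Qed.

End Fibers.

Section ToEll2.
Variables (R : realType) (I : choiceType).
Local Notation H := (ell2 R I).
Implicit Types (f g : H) (x : I -> R[i]).

Definition to_ell2 x : H := insubd (0 : H) x.

Lemma to_ell2E x : (sqsum x < +oo)%E -> ell2_fun (to_ell2 x) = x.
Proof. by move=> xfin; rewrite /to_ell2 insubdK//; apply/asboolP. Qed.

Lemma sqsum_le x f : (forall i, sqmod (x i) <= sqmod (f i)) -> (sqsum x < +oo)%E.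
Proof.
move=> xf; apply: le_lt_trans (sqsum_lty f); apply: le_esum => i _.
by rewrite lee_fin.
Qed.

Lemma ell2D f g i : (f + g) i = f i + g i. Proof. by []. Qed.
Lemma ell2Z c f i : (c *: f) i = c * f i. Proof. by []. Qed.
Lemma ell20 i : (0 : H) i = 0. Proof. by []. Qed.

Lemma sqsum_basis (u : I) : sqsum (fun v => (v == u)%:R : R[i]) = 1%:E.
Proof.
rewrite /sqsum -[RHS](@esum_set1 R I u (fun=> 1%:E))//.
rewrite [RHS]esum_mkcond; apply: eq_esum => v _.
have -> : (v \in [set u]) = (v == u) by apply/idP/eqP; rewrite inE.
by case: eqP => _; rewrite ?sqmod0// (sqmod_real 1) expr1n.
Qed.

Definition basis (u : I) : H := to_ell2 (fun v => (v == u)%:R).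

Lemma basisE u v : basis u v = (v == u)%:R.
Proof. by rewrite /basis to_ell2E// sqsum_basis ltry. Qed.

Lemma csum_at (u : I) (c : R[i]) : csum (fun v => if v == u then c else 0) = c.
Proof.
have rs (r : R) : rsum (fun v : I => if v == u then r else 0) = r.
  have es (q : R) : 0 <= q ->
      \esum_(v in [set: I]) (if v == u then q else 0)%:E = q%:E.
    move=> q0; rewrite -[RHS](@esum_set1 R I u (fun=> q%:E))//.
    rewrite [RHS]esum_mkcond; apply: eq_esum => v _.
    have -> : (v \in [set u]) = (v == u) by apply/idP/eqP; rewrite inE.
    by case: eqP.
  rewrite /rsum (eq_esum (b := fun v => (if v == u then Num.max r 0 else 0)%:E));
    last by move=> v _; case: eqP; rewrite ?maxxx.
  rewrite [in X in _ - X](eq_esum (b := fun v => (if v == u then Num.max (- r) 0 else 0)%:E));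
    last by move=> v _; case: eqP; rewrite ?oppr0 ?maxxx.
  rewrite !es ?le_max ?lexx ?orbT//=.
  have [r0|r0] := leP r 0; first by rewrite max_l ?oppr_ge0// opprK add0r.
  by rewrite max_r ?subr0// oppr_le0 ltW.
apply/eqP; rewrite eq_complex /csum /=; apply/andP; split; apply/eqP.
- by rewrite -[RHS]rs; congr rsum; apply/funext => v; case: eqP.
- by rewrite -[RHS]rs; congr rsum; apply/funext => v; case: eqP.
Qed.

Lemma dotp_basisr f u : dotp f (basis u) = f u.
Proof.
rewrite dotpE -[RHS](csum_at u); apply: eq_csum => v; rewrite basisE.
by case: eqP => [->|_]; rewrite ?conjC1 ?mulr1 ?conjC0 ?mulr0.
Qed.

Lemma dotp_basisl f u : dotp (basis u) f = Num.conj (f u).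
Proof. by rewrite dotpC dotp_basisr. Qed.

End ToEll2.

Section LiftCoef.
Variables (R : realType) (I : choiceType).
Local Notation H := (ell2 R I).
Variables (p : I -> I) (gam : I -> R) (s : I -> nat).
Hypothesis gam1 : forall u,
  \esum_(v in [set: I]) (if p v == u then gam v ^+ 2 else 0)%:E = 1%:E.
Implicit Types (f g x y : H) (u v : I).

Lemma sqsum_lift (x : I -> R[i]) :
  sqsum (fun v => (gam v)%:C * x (p v)) = sqsum x.
Proof.
rewrite /sqsum (esum_fiber p); last by move=> v; rewrite lee_fin sqmod_ge0.
apply: eq_esum => u _; rewrite -[RHS]mule1 -(gam1 u) -esumZr ?sqmod_ge0//; last first.
  by move=> v; rewrite lee_fin; case: ifP; rewrite ?sqr_ge0.
apply: eq_esum => v _; case: eqP => [->|_]; last by rewrite mule0.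
by rewrite -EFinM sqmodZ sqmod_real mulrC.
Qed.

(** The isometry sending the basis vector at u to the unit vector \sum_v gam v e_v
    over the fiber of u, and its adjoint [coef]. *)
Definition lift x : H := to_ell2 (fun v => (gam v)%:C * x (p v)).

Lemma liftE x v : lift x v = (gam v)%:C * x (p v).
Proof. by rewrite /lift to_ell2E// sqsum_lift sqsum_lty. Qed.

Lemma nsq_lift x : nsq (lift x) = nsq x.
Proof.
apply: EFin_inj; rewrite !nsqE -[RHS]sqsum_lift; congr sqsum.
by apply/funext => v; rewrite liftE.
Qed.

Lemma liftD x y : lift (x + y) = lift x + lift y.
Proof. by apply: ell2_ext => v; rewrite ell2D !liftE ell2D mulrDr. Qed.

Lemma liftZ c x : lift (c *: x) = c *: lift x.
Proof. by apply: ell2_ext => v; rewrite ell2Z !liftE ell2Z mulrCA. Qed.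

Lemma lift0 : lift 0 = 0.
Proof. by apply: ell2_ext => v; rewrite liftE ell20 mulr0. Qed.

Definition fiber_vec u : H := lift (basis R u).

Lemma fiber_vecE u v : fiber_vec u v = if p v == u then (gam v)%:C else 0.
Proof. by rewrite liftE basisE; case: eqP; rewrite ?mulr1 ?mulr0. Qed.

Lemma nsq_basis u : nsq (basis R u) = 1.
Proof.
apply: EFin_inj; rewrite nsqE -[RHS](sqsum_basis R u); congr sqsum.
by apply/funext => v; rewrite basisE.
Qed.

Opaque lift.

Lemma nsq_fiber_vec u : nsq (fiber_vec u) = 1.
Proof. by rewrite nsq_lift nsq_basis. Qed.

Opaque fiber_vec.

Definition cut u f : H := to_ell2 (fun v => if p v == u then f v else 0).

Lemma cutE u f v : cut u f v = if p v == u then f v else 0.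
Proof.
rewrite /cut to_ell2E//; apply: (@sqsum_le _ _ _ f) => w.
by case: ifP => // _; rewrite sqmod0 sqmod_ge0.
Qed.

Opaque cut.

Lemma dotp_fiber_vec u f :
  dotp f (fiber_vec u) = csum (fun v => if p v == u then (gam v)%:C * f v else 0).
Proof.
rewrite dotpE; apply: eq_csum => v; rewrite fiber_vecE.
case: eqP => _; last by rewrite conjC0 mulr0.
by rewrite mulrC; congr (_ * _); exact: conjc_real.
Qed.

(** Bessel's inequality, by Cauchy-Schwarz on each fiber. *)
Lemma bessel f : (sqsum (fun u => dotp f (fiber_vec u)) < +oo)%E.
Proof.
apply: le_lt_trans (sqsum_lty f); rewrite [leRHS]/sqsum (esum_fiber p); last first.
  by move=> v; rewrite lee_fin sqmod_ge0.
apply: le_esum => u _.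
have -> : dotp f (fiber_vec u) = dotp (cut u f) (fiber_vec u).
  by rewrite !dotp_fiber_vec; apply: eq_csum => v; rewrite cutE; case: eqP.
apply: (@le_trans _ _ (nsq (cut u f) * nsq (fiber_vec u))%:E).
  by rewrite lee_fin cauchy_schwarz.
rewrite nsq_fiber_vec mulr1 nsqE; apply: le_esum => v _.
by rewrite cutE; case: eqP => // _; rewrite sqmod0.
Qed.

Definition coef f : H := to_ell2 (fun u => dotp f (fiber_vec u)).

Lemma coefE f u : coef f u = dotp f (fiber_vec u).
Proof. by rewrite /coef to_ell2E// bessel. Qed.

Opaque coef.

Lemma coefD f g : coef (f + g) = coef f + coef g.
Proof. by apply: ell2_ext => u; rewrite ell2D !coefE dotpDl. Qed.

Lemma coefZ c f : coef (c *: f) = c *: coef f.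
Proof. by apply: ell2_ext => u; rewrite ell2Z !coefE dotpZl. Qed.

Lemma coefB f g : coef (f - g) = coef f - coef g.
Proof. by rewrite coefD -scaleN1r coefZ scaleN1r. Qed.

Lemma dotp_lift x f : dotp (lift x) f = dotp x (coef f).
Proof.
rewrite !dotpE (csum_fiber p); last exact: csummable_dotp.
apply: eq_csum => u; rewrite coefE -[Num.conj _]dotpC dotpE -csumZ; last exact: csummable_dotp.
apply: eq_csum => v; rewrite liftE fiber_vecE; case: eqP => [->|_]; last by rewrite mul0r mulr0.
by rewrite mulrA [_ * x u]mulrC.
Qed.

Lemma dotp_liftr x f : dotp f (lift x) = dotp (coef f) x.
Proof. by rewrite dotpC dotp_lift -dotpC. Qed.

Lemma dotp_lift2 x y : dotp (lift x) (lift y) = dotp x y.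
Proof.
have ReE c : complex.Re (Num.conj c * dotp (lift x) (lift y)) =
             complex.Re (Num.conj c * dotp x y).
  have := nsq_lift (x + c *: y); rewrite liftD liftZ !nsqDZ !nsq_lift; lra.
apply/eqP; rewrite eq_complex; apply/andP; split; apply/eqP.
  by have := ReE 1; rewrite conjC1 !mul1r.
have := ReE 'i%C.
by case: (dotp (lift x) (lift y)) (dotp x y) => [a b] [c d] /=; lra.
Qed.

Lemma coef_lift x : coef (lift x) = x.
Proof.
by apply: dotp_inj => y; rewrite -dotp_liftr dotp_lift2.
Qed.

Lemma nsq_coef_le f : nsq (coef f) <= nsq f.
Proof.
have := nsq_ge0 (f - lift (coef f)).
by rewrite nsqB dotp_liftr dotpp nsq_lift /=; lra.
Qed.

Definition level n f : H := to_ell2 (fun u => if s u == n then f u else 0).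

Lemma levelE n f u : level n f u = if s u == n then f u else 0.
Proof.
rewrite /level to_ell2E//; apply: (@sqsum_le _ _ _ f) => w.
by case: ifP => // _; rewrite sqmod0 sqmod_ge0.
Qed.
Opaque level.

Lemma levelD n f g : level n (f + g) = level n f + level n g.
Proof.
by apply: ell2_ext => u; rewrite ell2D !levelE; case: ifP; rewrite ?addr0.
Qed.

Lemma levelZ n c f : level n (c *: f) = c *: level n f.
Proof.
by apply: ell2_ext => u; rewrite ell2Z !levelE; case: ifP; rewrite ?mulr0.
Qed.

Lemma level_sym n f g : dotp (level n f) g = dotp f (level n g).
Proof.
rewrite !dotpE; apply: eq_csum => u; rewrite !levelE.
by case: ifP => _ //; rewrite conjC0 mulr0 mul0r.
Qed.

Lemma level_level m n f : level m (level n f) = if m == n then level n f else 0.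
Proof.
apply: ell2_ext => u; rewrite !levelE; case: (eqVneq m n) => [<-|mn].
  by rewrite levelE; case: (s u == m).
rewrite ell20; case: eqP => // sm; case: eqP => // sn.
by case/eqP: mn; rewrite -sm.
Qed.

Lemma esum_level (w : nat -> R) f : (forall n, 0 <= w n) ->
  \esum_(u in [set: I]) (w (s u) * sqmod (f u))%:E =
  \esum_(n in [set: nat]) (w n * nsq (level n f))%:E.
Proof.
move=> w0; rewrite (esum_fiber s); last first.
  by move=> u; rewrite lee_fin mulr_ge0 ?sqmod_ge0.
apply: eq_esum => n _; rewrite EFinM nsqE -esumZr//; last first.
  by move=> u; rewrite lee_fin sqmod_ge0.
apply: eq_esum => u _; rewrite levelE.
case: eqP => [->|_]; first by rewrite EFinM.
by rewrite sqmod0 mule0.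
Qed.

(** P_0 projects onto the kernel of [coef], and P_(n+1) onto the span of the
    vectors [fiber_vec u] with u on level n. *)
Definition level_proj (n : nat) f : H :=
  if n is m.+1 then lift (level m (coef f)) else f - lift (coef f).

Lemma esum_nat_recl (F : nat -> R) : (forall n, 0 <= F n) ->
  (\esum_(n in [set: nat]) (F n)%:E =
   (F 0%N)%:E + \esum_(n in [set: nat]) (F n.+1)%:E)%E.
Proof.
move=> F0; rewrite (esumID [set 0%N]); last by move=> n _; rewrite lee_fin.
rewrite !setTI esum_set1 ?lee_fin//; congr (_ + _)%E.
rewrite -(esum_image [set: nat] succn (fun n => (F n)%:E))//; last by move=> m n _ _ [].
congr esum; apply/seteqP; split=> [[|n] //= n0|_ [n _ <-] //].
by exists n.
Qed.

Lemma coef_lift0 f : coef (f - lift (coef f)) = 0.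
Proof. by rewrite coefB coef_lift subrr. Qed.

Lemma nsq_lift_split f : nsq f = nsq (f - lift (coef f)) + nsq (coef f).
Proof. by rewrite nsqB dotp_liftr dotpp nsq_lift /=; ring. Qed.

Lemma level_proj_resolution : resolution level_proj.
Proof.
split.
- move=> [|n] c f g /=.
    rewrite coefD coefZ liftD liftZ scalerBr opprD addrACA //.
  by rewrite coefD coefZ levelD levelZ liftD liftZ.
- move=> [|n] f g /=.
    by rewrite dotpBl dotpBr dotp_lift dotp_liftr.
  by rewrite dotp_lift dotp_liftr level_sym.
- move=> [|m] [|n] f /=.
  + by rewrite coef_lift0 lift0 subr0.
  + by rewrite coef_lift subrr.
  + by rewrite coef_lift0 -(scale0r 0) levelZ !scale0r lift0.
  + by rewrite coef_lift level_level eqSS; case: eqP => // _; rewrite lift0.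
- move=> f; rewrite esum_nat_recl; last by move=> n; exact: nsq_ge0.
  rewrite /= [in RHS]nsq_lift_split EFinD; congr (_ + _)%E.
  rewrite nsqE /sqsum.
  have := @esum_level (fun=> 1) (coef f) (fun=> ler01).
  under eq_esum do rewrite mul1r; move=> ->.
  by apply: eq_esum => n _; rewrite mul1r nsq_lift.
move=> b f bf.
have bC : (sqsum (fun u => (b (s u).+1)%:C * coef f u)%R < +oo)%E.
  rewrite /sqsum; under eq_esum do rewrite sqmodZ sqmod_real.
  rewrite (@esum_level (fun n => b n.+1 ^+ 2)); last by move=> n; exact: sqr_ge0.
  apply: le_lt_trans bf; rewrite [leRHS]esum_nat_recl; last first.
    by move=> n; rewrite mulr_ge0 ?sqr_ge0 ?nsq_ge0.
  rewrite -[leLHS]add0e; apply: leeD.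
    by rewrite lee_fin mulr_ge0 ?sqr_ge0 ?nsq_ge0.
  by apply: le_esum => n _; rewrite /= nsq_lift.
have [y yE] := ell2P bC.
exists (lift y + (b 0%N)%:C *: (f - lift (coef f))) => -[|n] /=.
  by rewrite coefD coefZ coef_lift coef_lift0 scaler0 addr0 addrC addKr.
rewrite coefD coefZ coef_lift coef_lift0 scaler0 addr0 -liftZ; congr lift.
apply: ell2_ext => u; rewrite [LHS]levelE [RHS]ell2Z levelE yE.
by case: eqP => [->|]; rewrite ?mulr0.
Qed.

End LiftCoef.

Opaque lift fiber_vec cut coef level.

(** * Shifts with weights constant on levels, up to normalization *)

Section Shift.
Variables (R : realType) (I : choiceType).
Local Notation H := (ell2 R I).
Variables (p : I -> I) (gam : I -> R) (s : I -> nat) (theta : nat -> R).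
Hypothesis gam1 : forall u,
  \esum_(v in [set: I]) (if p v == u then gam v ^+ 2 else 0)%:E = 1%:E.
Hypothesis theta1 : forall n, 1 <= theta n.
Implicit Types (f g h x y : H) (u v w : I).

Local Notation lift := (@lift R I p gam).
Local Notation coef := (@coef R I p gam).
Local Notation fiber_vec := (@fiber_vec R I p gam).
Local Notation P := (@level_proj R I p gam s).
Local Notation resP := (@level_proj_resolution R I p gam s gam1).
Local Notation e_ := (@basis R I).

Let theta_gt0 n : 0 < theta n.
Proof. exact: lt_le_trans (theta1 n). Qed.

Let theta_neq0 n : (theta n)%:C != 0 :> R[i].
Proof. by rewrite eq_complex /= eqxx andbT gt_eqF. Qed.

(** The weighted shift along p with weights gam v * theta (s (p v)), that is,
    [lift] after multiplication by theta o s. *)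
Definition level_shift : set (H * H) :=
  [set q : H * H | (\esum_(u in [set: I]) (theta (s u) ^+ 2 * sqmod (q.1 u))%:E < +oo)%E
    /\ forall v, q.2 v = (gam v * theta (s (p v)))%:C * q.1 (p v)].

Lemma level_proj_fiber_vec n u : P n.+1 (fiber_vec u) = if s u == n then fiber_vec u else 0.
Proof.
rewrite /level_proj (_ : fiber_vec u = lift (e_ u))// (coef_lift gam1).
have -> : level s n (e_ u) = if s u == n then e_ u else 0.
  apply: ell2_ext => v; rewrite levelE basisE; case: (eqVneq v u) => [->|vu].
    by case: eqP; rewrite ?basisE ?eqxx.
  by case: eqP => // _; case: eqP; rewrite ?basisE ?(negbTE vu).
by case: eqP => // _; rewrite (lift0 gam1).
Qed.

Lemma level_proj0_fiber_vec u : P 0 (fiber_vec u) = 0.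
Proof. by rewrite /level_proj (_ : fiber_vec u = lift (e_ u))// (coef_lift gam1) subrr. Qed.

(** The adjoint is [coef] followed by multiplication by theta o s: testing on
    basis vectors forces this formula, and the adjunction between [lift] and
    [coef] shows that it suffices. *)
Lemma adjoint_level_shift : adjoint level_shift =
  [set q : H * H | forall u, q.2 u = (theta (s u))%:C * coef q.1 u].
Proof.
apply/seteqP; split=> [[f g] /= fg u|[f g] /= fg [h k] [/= hfin hk]].
  have Se : level_shift (e_ u, (theta (s u))%:C *: fiber_vec u).
    split=> [|v] /=.
      apply: le_lt_trans (ltry (theta (s u) ^+ 2)).
      rewrite -[leRHS](@esum_set1 R I u (fun=> (theta (s u) ^+ 2)%:E)) ?lee_fin ?sqr_ge0//.
      rewrite [leRHS]esum_mkcond; apply: le_esum => v _; rewrite basisE.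
      have -> : (v \in [set u]) = (v == u) by apply/idP/eqP; rewrite inE.
      by case: eqP => [->|_]; rewrite ?sqmod0 ?mulr0// (sqmod_real 1) expr1n mulr1.
    rewrite [LHS](_ : _ = (theta (s u))%:C * fiber_vec u v)//.
    rewrite (fiber_vecE gam1) basisE; case: eqP => [->|_]; last by rewrite !mulr0.
    by rewrite mulr1 rmorphM mulrC.
  apply: (can_inj conjCK); rewrite conjM conj_real (coefE gam1) -dotpC.
  by have := fg _ Se; rewrite /= dotpZl dotp_basisl => <-.
have thin : (sqsum (fun u => (theta (s u))%:C * h u)%R < +oo)%E.
  apply: le_lt_trans hfin; apply: le_esum => u _.
  by rewrite sqmodZ sqmod_real.
have [y yE] := ell2P thin.
have -> : k = lift y.
  by apply: ell2_ext => v; rewrite hk liftE// yE rmorphM mulrA.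
rewrite dotp_lift// !dotpE; apply: eq_csum => u.
by rewrite yE fg conjM conj_real mulrCA mulrA.
Qed.

Definition sqr_wt n : R := if n is m.+1 then theta m ^+ 2 else 0.
Definition wt n : R := if n is m.+1 then theta m else 0.

Local Notation T := (adjoint level_shift).

Lemma adjointE f g : T (f, g) <-> forall u, g u = (theta (s u))%:C * coef f u.
Proof. by rewrite adjoint_level_shift. Qed.

Lemma level_projS n f : P n.+1 f = lift (level s n (coef f)). Proof. by []. Qed.
Lemma level_proj0 f : P 0 f = f - lift (coef f). Proof. by []. Qed.

Lemma levelS_coef n f u : s u = n -> coef (P n.+1 f) u = coef f u.
Proof. by move=> su; rewrite /level_proj (coef_lift gam1) levelE su eqxx. Qed.

Lemma diag_coef b f g : diag P b (f, g) ->
  forall u, coef g u = (b (s u).+1)%:C * coef f u.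
Proof.
move=> fg u; rewrite -(levelS_coef g (erefl (s u))) (fg (s u).+1).
by rewrite (coefZ gam1) ell2Z levelS_coef.
Qed.

Lemma adjoint_test n y : T (P n y, (wt n)%:C *: coef (P n y)).
Proof.
apply/adjointE => u; rewrite ell2Z; case: n => [|n].
  by rewrite /level_proj (coef_lift0 gam1) ell20 !mulr0.
by rewrite /level_proj (coef_lift gam1) levelE; case: eqP => [->//|]; rewrite !mulr0.
Qed.

(** For a pair in the diagonal operator, the intermediate vector z is
    square-summable because theta >= 1 bounds theta |c| by theta^2 |c|. *)
Lemma adjoint_adjoint_comp : (adjoint T \; T)%relation = diag P sqr_wt.
Proof.
apply/seteqP; split=> [[f g] [/= z /adjointE fz zg] n|[f g] fg].
  apply: dotp_inj => y; rewrite [P n _]/= (res_sym resP) [LHS]dotpC [RHS]dotpC.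
  congr (Num.conj _); have := zg _ (adjoint_test n y); rewrite /= => <-.
  case: n => [|n].
    by rewrite /wt scale0r dotp0l [sqr_wt _]/sqr_wt scale0r dotp0r.
  have -> : dotp y ((sqr_wt n.+1)%:C *: P n.+1 f) =
      (theta n ^+ 2)%:C * dotp (level s n (coef y)) (coef f).
    by rewrite dotpZr conj_real level_projS (dotp_liftr gam1) -level_sym.
  rewrite dotpZl level_projS (coef_lift gam1) expr2 rmorphM -mulrA; congr (_ * _).
  rewrite -dotpZl !dotpE; apply: eq_csum => u; rewrite ell2Z levelE fz conjM conj_real.
  by case: eqP => [->|_]; rewrite ?mul0r ?mulr0 ?mul0r// mulrCA mulrA.
have gC u := diag_coef fg u.
have gE : g = lift (coef g).
  apply/eqP; rewrite -subr_eq0 -level_proj0; apply/eqP.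
  by rewrite (fg 0%N) scale0r.
have zfin : (sqsum (fun u => (theta (s u))%:C * coef f u)%R < +oo)%E.
  apply: (@sqsum_le _ _ _ (coef g)) => u; rewrite gC !sqmodZ !sqmod_real.
  rewrite ler_wpM2r ?sqmod_ge0// /sqr_wt -[leLHS]mulr1 [leRHS]expr2.
  have := theta1 (s u); have : 1 <= theta (s u) ^+ 2 by rewrite exprn_ege1.
  by move=> t1 _; rewrite ler_wpM2l ?sqr_ge0.
have [z zE] := ell2P zfin.
exists z; first by apply/adjointE => u; rewrite zE.
move=> [x k] /adjointE xk /=.
rewrite gE (dotp_liftr gam1) !dotpE; apply: eq_csum => u.
rewrite xk zE gC !conjM !conj_real /sqr_wt expr2 rmorphM mulrCA !mulrA.
by rewrite [(theta _)%:C * _ * _]mulrC !mulrA.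
Qed.

Lemma oabs_adjoint : oabs T = diag P wt.
Proof.
rewrite /oabs adjoint_adjoint_comp (opow_diag resP); congr diag.
apply/funext => -[|n] /=; first by rewrite powR0// invr_neq0.
by rewrite powR12_sqrt ?sqr_ge0// sqrtr_sqr ger0_norm// ltW.
Qed.

Lemma coef_partial_isometry : partial_isometry coef.
Proof.
split=> [c f g|f|f fker].
- by rewrite (coefD gam1) (coefZ gam1).
- have fid : id @ nbhs f --> f by exact: cvg_id.
  apply: (@cvgrPdist_lt _ _ _ (nbhs f) _ coef (coef f)).2 => e e0.
  move/cvgrPdist_lt : fid => /(_ e e0).
  apply: filterS => g; rewrite -(coefB gam1); apply: le_lt_trans.
  by rewrite !normE lecR ler_sqrt ?nsq_ge0//; exact: nsq_coef_le.
- have := fker (f - lift (coef f)) (coef_lift0 gam1 f).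
  rewrite dotpBr dotpp (dotp_liftr gam1) dotpp !normE => /eqP.
  by rewrite subr_eq0 => /eqP [->].
Qed.

Lemma coef_kernel : [set f | coef f = 0] = okernel T.
Proof.
apply/seteqP; split=> f; rewrite /okernel /= adjointE.
  by move=> f0 u; rewrite f0 ell20 mulr0.
move=> fu; apply: ell2_ext => u; apply/eqP; have /esym/eqP := fu u.
by rewrite !ell20 mulf_eq0 (negbTE (theta_neq0 _)).
Qed.

Lemma polar_decomposition : T = (ograph coef \; oabs T)%relation.
Proof.
rewrite [in RHS]oabs_adjoint; apply/seteqP; split=> [[f g] /adjointE fg|[f g] [/= z fz gz]].
  exists (lift g); last by rewrite /ograph /= (coef_lift gam1).
  move=> [|n]; rewrite [(_, _).2]/= [(_, _).1]/=.
    by rewrite level_proj0 (coef_lift gam1) subrr scale0r.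
  have gE : level s n g = (theta n)%:C *: level s n (coef f).
    apply: ell2_ext => u; rewrite [LHS]levelE fg [RHS]ell2Z levelE.
    by case: eqP => [->|_]; rewrite ?mulr0.
  by rewrite !level_projS (coef_lift gam1) gE (liftZ gam1).
by apply/adjointE => u; rewrite (_ : g = coef z)//; exact: diag_coef fz u.
Qed.

Lemma polar_factorP : linear (polar_factor T) /\
  T = (ograph (polar_factor T) \; oabs T)%relation.
Proof.
have ex : [set U | [/\ partial_isometry U, [set f | U f = 0] = okernel T
    & T = (ograph U \; oabs T)%relation]] !=set0.
  exists coef; split; [exact: coef_partial_isometry|exact: coef_kernel|].
  exact: polar_decomposition.
by have [[Ulin _ _] _ UT] := xgetPex (fun=> 0) ex.
Qed.

Lemma polar_factorZ c f : polar_factor T (c *: f) = c *: polar_factor T f.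
Proof.
have [] := polar_factorP; move: (polar_factor T) => U Ulin _.
have U0 : U 0 = 0.
  by have := Ulin 1 0 0; rewrite !scale1r addr0 -[LHS]addr0 => /addrI <-.
by have := Ulin c f 0; rewrite U0 !addr0.
Qed.

Lemma diag_fiber_vec b c u :
  diag P b (c *: fiber_vec u, ((b (s u).+1)%:C * c) *: fiber_vec u).
Proof.
move=> [|n]; rewrite [(_, _).2]/= [(_, _).1]/= !(resZ resP).
  by rewrite level_proj0_fiber_vec !scaler0.
by rewrite level_proj_fiber_vec; case: eqP => [->|_]; rewrite ?scalerA// !scaler0.
Qed.

Lemma coef_fiber_vec u : coef (fiber_vec u) = e_ u.
Proof. by rewrite (_ : fiber_vec u = lift (e_ u))// (coef_lift gam1). Qed.

(** The polar factor U is determined at g = fiber_vec u by T = U |T|: since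
    |T| g = theta g, the vector theta U g is T g. *)
Lemma polar_factor_fiber_vec u : polar_factor T (fiber_vec u) = e_ u.
Proof.
have : T (fiber_vec u, (theta (s u))%:C *: polar_factor T (fiber_vec u)).
  rewrite -polar_factorZ {1}(proj2 polar_factorP).
  exists ((theta (s u))%:C *: fiber_vec u) => //=.
  by rewrite oabs_adjoint; have := diag_fiber_vec wt 1 u; rewrite scale1r mulr1.
rewrite adjointE => Uu; apply: ell2_ext => v; apply: (mulfI (theta_neq0 (s u))).
rewrite -ell2Z Uu coef_fiber_vec basisE.
by case: eqP => [->//|_]; rewrite !mulr0.
Qed.

Lemma coef_basis u : coef (e_ u) = (gam u)%:C *: e_ (p u).
Proof.
apply: ell2_ext => v; rewrite (coefE gam1) dotp_basisl (fiber_vecE gam1) [RHS]ell2Z basisE.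
by rewrite eq_sym; case: eqP => _; rewrite ?conjC0 ?conj_real ?mulr1 ?mulr0.
Qed.

Lemma diag_basis b c u : b 0%N = 0 -> diag P b (c *: e_ u,
  ((b (s (p u)).+1 * gam u)%:C * c) *: fiber_vec (p u)).
Proof.
move=> b0 [|n]; rewrite [(_, _).2]/= [(_, _).1]/= !(resZ resP).
  by rewrite level_proj0_fiber_vec b0 !(scaler0, scale0r).
have -> : P n.+1 (e_ u) = (gam u)%:C *: P n.+1 (fiber_vec (p u)).
  by rewrite !level_projS coef_basis coef_fiber_vec levelZ (liftZ gam1).
rewrite level_proj_fiber_vec; case: eqP => [->|_]; last by rewrite !scaler0.
by rewrite !scalerA rmorphM; congr (_ *: _); ring.
Qed.

Definition aluthge_coef t u : R :=
  theta (s u) `^ (1 - t) * (theta (s (p u)) `^ t * gam u).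

(** The Aluthge transform sends the unit vector of the fiber over u to a multiple
    of that of the fiber containing u: only its component in the range of |T|
    survives the left factor |T|^t. *)
Lemma aluthge_fiber_vec t c u : 0 < t ->
  aluthge t T (c *: fiber_vec u, ((aluthge_coef t u)%:C * c) *: fiber_vec (p u)).
Proof.
move=> t0; rewrite /aluthge oabs_adjoint !(opow_diag resP).
exists ((theta (s u) `^ (1 - t))%:C * c *: e_ u).
  exists ((theta (s u) `^ (1 - t))%:C * c *: fiber_vec u); first exact: diag_fiber_vec.
  by rewrite /ograph /= polar_factorZ polar_factor_fiber_vec.
have b0 : wt 0 `^ t = 0 by rewrite /wt powR0// gt_eqF.
have := @diag_basis (fun n => wt n `^ t) ((theta (s u) `^ (1 - t))%:C * c) u b0.
have -> : (wt (s (p u)).+1 `^ t * gam u)%:C * ((theta (s u) `^ (1 - t))%:C * c)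
    = (aluthge_coef t u)%:C * c.
  by rewrite mulrA -rmorphM [X in X%:C * _]mulrC.
exact.
Qed.

Lemma fiber_vec_neq0 u : fiber_vec u <> 0.
Proof.
move=> g0; have := nsq_fiber_vec gam1 u; rewrite g0 nsq0 => /eqP.
by rewrite eq_sym oner_eq0.
Qed.

(** Along the children u of w, the vectors fiber_vec u / aluthge_coef t u tend to 0
    while their images are constantly fiber_vec w. *)
Theorem aluthge_not_closable t w : 0 < t ->
    (forall M, exists2 u, p u = w & M < aluthge_coef t u) ->
  ~ closable (aluthge t T).
Proof.
move=> t0 unbounded cl; apply: (@fiber_vec_neq0 w); apply: (cl 0).
- move=> B [[X Y] [/= nX nY] XY].
  move/nbhs_norm0P : nX => [_ /gt0_complexE[r r0 ->] Xr].
  have [u uw Mu] := unbounded r^-1.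
  have cu0 : 0 < aluthge_coef t u by apply: lt_trans Mu; rewrite invr_gt0.
  exists ((aluthge_coef t u)^-1%:C *: fiber_vec u, fiber_vec w); split.
    have := @aluthge_fiber_vec t (aluthge_coef t u)^-1%:C u t0.
    by rewrite uw -rmorphM mulfV ?gt_eqF// scale1r.
  apply: XY; split => /=; last exact: nbhs_singleton.
  apply: Xr => /=; rewrite norm_ltE// nsqZ nsq_fiber_vec// mulr1 sqmod_real.
  by rewrite ltr_pXn2r ?nnegrE ?invr_ge0 ?ltW// invf_plt.
- have [u uw _] := unbounded 0; apply: subset_closure.
  by have := @aluthge_fiber_vec t 0 u t0; rewrite mulr0 !scale0r.
Qed.

End Shift.

(** * The tree of sequences *)

Section IntegerSets.
Implicit Types (A : set int) (x m b : int).

Lemma int_has_max A x : A x -> has_ubound A -> exists m, A m /\ ubound A m.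
Proof.
move=> Ax [b Ab]; have xb : x <= b by exact: Ab.
have : exists n : nat, ubound A (x + n%:Z).
  by exists `|b - x|%N => y /Ab yb; lia.
case=> n; elim: n => [|n ih] An; first by exists x; split=> // y /An; lia.
have [An1|An1] := pselect (A (x + n.+1%:Z)); first by exists (x + n.+1%:Z).
apply: ih => y Ay; have := An _ Ay; rewrite le_eqVlt => /predU1P[yn|]; last by lia.
by case: An1; rewrite -yn.
Qed.

Lemma int_has_min A x : A x -> has_lbound A -> exists m, A m /\ lbound A m.
Proof.
move=> Ax [b Ab].
have [||m [Am mub]] := @int_has_max [set y | A (- y)] (- x).
- by rewrite /= opprK.
- by exists (- b) => y /= /Ab; lia.
by exists (- m); split=> // y Ay; have := mub (- y); rewrite /= opprK => /(_ Ay); lia.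
Qed.

Lemma supremum_max A m : A m -> ubound A m -> supremum 0 A = m.
Proof.
move=> Am mA; rewrite /supremum; case: ifPn => [/eqP A0|_].
  by rewrite A0 in Am.
have ms : supremums A m by split=> // b; exact.
by case: xgetP => [y _ ys|/(_ m)//]; exact: is_subset1_supremums ys ms.
Qed.

Lemma infimum_min A m : A m -> lbound A m -> infimum 0 A = m.
Proof.
move=> Am mA; rewrite /infimum; case: ifPn => [/eqP A0|_].
  by rewrite A0 in Am.
have ms : infimums A m by split=> // b; exact.
by case: xgetP => [y _ ys|/(_ m)//]; exact: is_subset1_infimums ys ms.
Qed.

End IntegerSets.

Section Tree.
Implicit Types (u v w : V) (f : int -> int).

Lemma vM_eq f (N : int) : (forall n, (-1 < f n) = (n <= N)) -> vM f = N.
Proof.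
move=> fN; apply: supremum_max => [|n]; rewrite /vdom /= fN//.
Qed.

Lemma V_intro f (N : int) : (forall n, -1 <= f n) ->
  (forall n, (-1 < f n) = (n <= N)) -> has_lbound (vsupp f) -> V f /\ vM f = N.
Proof.
move=> f1 fN fl; have MN := vM_eq fN; split=> //; split=> //.
  by exists N => n; rewrite /vdom /= fN.
by move=> n; rewrite MN fN.
Qed.

Lemma V_gtN1 v n : (-1 < \val v n) = (n <= vM (\val v)).
Proof.
have [v1 vl vu vpos] := set_valP v.
apply/idP/idP => [vn|/vpos//].
have [m [vm mub]] := @int_has_max (vdom (\val v)) _ (vpos _ (lexx _)) vu.
have -> : vM (\val v) = m by exact: supremum_max.
exact: mub.
Qed.

Lemma V_out v n : vM (\val v) < n -> \val v n = -1.
Proof.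
move=> vn; have [v1 _ _ _] := set_valP v; have := V_gtN1 v n; have := v1 n; lia.
Qed.

Lemma V_ge0 v n : n <= vM (\val v) -> 0 <= \val v n.
Proof. by have := V_gtN1 v n; lia. Qed.

Lemma vmP v : [/\ \val v (vm (\val v) + 2) != 0,
  forall n, n < vm (\val v) + 2 -> \val v n = 0 &
  vm (\val v) + 1 <= vM (\val v)].
Proof.
have [v1 vl vu vpos] := set_valP v.
have vM1 : vsupp (\val v) (vM (\val v) + 1) by rewrite /vsupp /= V_out ?ltrDl.
have [i [vi il]] := int_has_min vM1 vl.
have vmE : vm (\val v) = i - 2 by rewrite /vm (infimum_min vi il).
rewrite vmE subrK; split=> //.
  move=> n ni; apply/eqP; apply: contraTT ni => vn.
  by rewrite -leNgt; exact: il.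
by have := il _ vM1; lia.
Qed.

Lemma edge_inj u u' v : edge u v -> edge u' v -> u = u'.
Proof.
move=> [Mu uv] [Mu' uv']; apply: val_inj; apply/funext => n.
have MM : vM (\val u) = vM (\val u') by lia.
have [nu|nu] := leP n (vM (\val u)); first by rewrite uv// uv'// -MM.
by rewrite !V_out// -MM.
Qed.

(** The parent of v is obtained by overwriting the last entry of v by -1. *)
Lemma edge_par v : edge (par v) v.
Proof.
pose M := vM (\val v).
pose f n := if n < M then \val v n else -1.
have [v1 [b vb] vu vpos] := set_valP v.
have [||| Vf fM] := @V_intro f (M - 1).
- by move=> n; rewrite /f; case: ifP.
- by move=> n; rewrite /f; have := V_gtN1 v n; case: ifP; lia.
- exists (Num.min b M) => n; rewrite /vsupp /f /= ge_min.
  by case: ifP => [_ /vb ->//|nM _]; apply/orP; right; lia.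
have : edge (exist _ f (mem_set Vf)) v.
  split=> /=; first by rewrite fM subrK.
  by move=> n; rewrite fM /f; case: ifP => //; lia.
by move=> ed; apply: (@xgetPex _ v [set u | edge u v]); eexists; exact: ed.
Qed.

Lemma parE u v : (par v == u) = `[< edge u v >].
Proof.
apply/eqP/asboolP => [<-|uv]; first exact: edge_par.
exact: edge_inj (edge_par v) uv.
Qed.

(** The children of u are obtained by appending a natural number. *)
Lemma extP u (k : nat) : exists w, [/\ edge u w,
  \val w (vM (\val w)) = k & vM (\val w) = vM (\val u) + 1].
Proof.
pose M := vM (\val u).
pose f n := if n == M + 1 then k%:Z else \val u n.
have [u1 [b ub] uu upos] := set_valP u.
have [||| Vf fM] := @V_intro f (M + 1).
- by move=> n; rewrite /f; case: ifP.
- by move=> n; rewrite /f; have := V_gtN1 u n; rewrite -/M; case: eqP; lia.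
- exists (Num.min b (M + 1)) => n; rewrite /vsupp /f /= ge_min.
  by case: (n =P M + 1) => [-> _|_ /ub -> //]; rewrite lexx orbT.
exists (exist _ f (mem_set Vf)); split; rewrite /= ?fM//.
  split=> [|n nM] /=; first by rewrite fM.
  by rewrite /f; case: eqP => // nE; move: nM; rewrite nE -/M; lia.
by rewrite /f eqxx.
Qed.

Definition ext u k : V := sval (cid (extP u k)).

Lemma ext_edge u k : edge u (ext u k).
Proof. by rewrite /ext; case: cid => w []. Qed.

Lemma ext_last u k : \val (ext u k) (vM (\val (ext u k))) = k.
Proof. by rewrite /ext; case: cid => w []. Qed.

Lemma par_ext u k : par (ext u k) = u.
Proof. by apply/eqP; rewrite parE; apply/asboolP; exact: ext_edge. Qed.

Lemma edge_last_inj u v v' : edge u v -> edge u v' ->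
  \val v (vM (\val v)) = \val v' (vM (\val v')) -> v = v'.
Proof.
move=> [Mv uv] [Mv' uv'] vv; apply: val_inj; apply/funext => n.
have [nu|nu] := leP n (vM (\val u)); first by rewrite -uv// -uv'.
have [nv|nv] := leP n (vM (\val v)); last by rewrite !V_out//; lia.
have -> : n = vM (\val v) by lia.
by rewrite vv; congr (\val v' _); lia.
Qed.

Lemma ext_bij u : set_bij [set: nat] [set v | par v == u] (ext u).
Proof.
split=> [k _|k l _ _ kl|v /=].
- by rewrite /= par_ext.
- by apply/eqP; rewrite -eqz_nat -(ext_last u k) kl ext_last.
rewrite parE => /asboolP uv; exists `|\val v (vM (\val v))|%N => //.
apply: (@edge_last_inj u) => //; first exact: ext_edge.
by rewrite ext_last gez0_abs// V_ge0.
Qed.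

Definition isum f (a b : int) : int := \sum_(0 <= k < `|b - a|%N) f (a + k%:Z).

Lemma isum_recr f a b : a <= b -> isum f a (b + 1) = isum f a b + f b.
Proof.
move=> ab; rewrite /isum.
have -> : `|(b + 1 - a)%R|%N = `|(b - a)%R|%N.+1 by lia.
by rewrite big_nat_recr//=; congr (_ + f _); lia.
Qed.

Lemma isum_start f a b c : a <= b -> b <= c ->
  (forall n, a <= n -> n < b -> f n = 0) -> isum f a c = isum f b c.
Proof.
move=> ab bc f0; rewrite /isum (big_cat_nat _ (n := `|(b - a)%R|%N))//=; last by lia.
rewrite big_nat big1 ?add0r; last by move=> k /andP[_ kb]; apply: f0; lia.
rewrite -[X in index_iota X]add0n big_addn.
have -> : (`|(c - a)%R| - `|(b - a)%R|)%N = `|(c - b)%R|%N by lia.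
by apply: eq_bigr => k _; congr f; lia.
Qed.

Lemma eq_isum f g a b : a <= b -> (forall n, a <= n -> n < b -> f n = g n) ->
  isum f a b = isum g a b.
Proof. by move=> ab fg; apply: eq_big_nat => k /andP[_ kb]; apply: fg; lia. Qed.

Definition vsum v : int := isum (\val v) (vm (\val v)) (vM (\val v) + 1).

(** [vm u] and [vm v] may differ, namely when all the entries of u vanish; the
    entries of u below either of them are 0, so that the sums agree. *)
Lemma isum_edge u v : edge u v ->
  isum (\val v) (vm (\val v)) (vM (\val v)) = vsum u.
Proof.
move=> [Mv uv]; have [_ u0 uM] := vmP u; have [_ v0 vM'] := vmP v.
have E : isum (\val v) (vm (\val v)) (vM (\val v)) =
         isum (\val u) (vm (\val v)) (vM (\val u) + 1).
  by rewrite Mv; apply: eq_isum => [|n _ nM]; [lia|rewrite uv//; lia].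
rewrite E /vsum; pose a := Num.min (vm (\val u)) (vm (\val v)).
have au : a <= vm (\val u) by rewrite ge_min lexx.
have av : a <= vm (\val v) by rewrite ge_min lexx orbT.
rewrite -(@isum_start _ a (vm (\val u)))//; last 2 first.
- by lia.
- by move=> n _ nu; apply: u0; lia.
rewrite -(@isum_start _ a (vm (\val v)))//; first by lia.
by move=> n _ nv; rewrite uv; [apply: v0; lia|lia].
Qed.

Lemma vsum_edge u v : edge u v -> vsum v = vsum u + \val v (vM (\val v)).
Proof.
move=> uv; rewrite -(isum_edge uv) /vsum isum_recr//.
by have [_ _] := vmP v; lia.
Qed.

Lemma vsum_ge0 v : 0 <= vsum v.
Proof.
rewrite /vsum /isum big_nat; apply: sumr_ge0 => k /andP[_ kM].
by have [_ _ vmM] := vmP v; apply: V_ge0; lia.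
Qed.

Definition vlevel v : nat := `|vsum v|%N.

Lemma vlevel_ext u k : vlevel (ext u k) = (vlevel u + k)%N.
Proof.
have := vsum_edge (ext_edge u k); rewrite ext_last /vlevel.
by have := vsum_ge0 u; lia.
Qed.

Lemma V_inhabited : exists v : V, True.
Proof.
pose f (n : int) : int := if n <= 0 then 0 else -1.
have [||| Vf _] := @V_intro f 0.
- by move=> n; rewrite /f; case: ifP.
- by move=> n; rewrite /f; case: ifP.
- by exists 0 => n; rewrite /vsupp /f /=; case: ifP => //; lia.
by exists (exist _ f (mem_set Vf)).
Qed.

End Tree.

(** * The weights on the tree *)

Section Weights.
Variable R : realType.
Implicit Types (u v w : V) (n k : nat).

Let sq (k : nat) : R := (k.+1%:R ^+ 2)^-1.

Let sq_ge0 k : 0 <= sq k.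
Proof. by rewrite invr_ge0 sqr_ge0. Qed.

(** Telescoping comparison of 1/k^2 with 1/(k - 1) - 1/k. *)
Let sq_sum n : \sum_(0 <= k < n.+1) sq k <= 2 - n.+1%:R^-1.
Proof.
elim: n => [|n ih]; first by rewrite big_nat1 /sq expr1n invr1; lra.
rewrite big_nat_recr//=; apply: le_trans (lerD ih (lexx _)) _.
rewrite /sq -[n.+2%:R]natr1.
have x0 : 0 < n.+1%:R :> R by rewrite ltr0n.
move: (n.+1%:R) x0 => x x0.
rewrite -subr_ge0.
have -> : 2 - (x + 1)^-1 - (2 - x^-1 + ((x + 1) ^+ 2)^-1) =
   (x * (x + 1) ^+ 2)^-1.
  by field; rewrite !gt_eqF// addr_gt0.
by rewrite invr_ge0 mulr_ge0 ?sqr_ge0 ?ltW.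
Qed.

Let sq_lty : (\esum_(k in [set: nat]) (sq k)%:E < +oo)%E.
Proof.
rewrite -nneseries_esumT; last by move=> k; rewrite lee_fin.
apply: (@le_lt_trans _ _ 2%:E); last exact: ltry.
apply: lime_le; first by apply: is_cvg_nneseries => k _ _; rewrite lee_fin.
near=> n; rewrite sumEFin lee_fin.
have [m ->] : exists m, n = m.+1 by exists n.-1; rewrite prednK//; near: n; exact: nbhs_infty_gt.
apply: le_trans (sq_sum m) _; by rewrite gerBl invr_ge0.
Unshelve. all: by end_near.
Qed.

(** The norm of the sequence (1 / (k + 1))_k, by which the weights of the
    children of any vertex are normalized. *)
Definition kappa : R := Num.sqrt (fine (\esum_(k in [set: nat]) (sq k)%:E)).

Let kappa2 : \esum_(k in [set: nat]) (sq k)%:E = (kappa ^+ 2)%:E.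
Proof.
have s0 : (0 <= \esum_(k in [set: nat]) (sq k)%:E)%E.
  by apply: esum_ge0 => k _; rewrite lee_fin.
by rewrite sqr_sqrtr ?fine_ge0// fineK// ge0_fin_numE.
Qed.

Let kappa_ge1 : 1 <= kappa.
Proof.
rewrite -[leLHS]sqrtr1 ler_wsqrtr// -lee_fin fineK; last first.
  by rewrite ge0_fin_numE// esum_ge0// => k _; rewrite lee_fin.
rewrite (esumID [set 0%N]); last by move=> k _; rewrite lee_fin.
rewrite setTI esum_set1 ?lee_fin// {1}/sq expr1n invr1 leeDl// esum_ge0// => k _.
by rewrite lee_fin.
Qed.

Let kappa_neq0 : kappa != 0.
Proof. by rewrite gt_eqF// (lt_le_trans ltr01). Qed.

Definition vlast v : nat := `|\val v (vM (\val v))|%N.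

Lemma vlast_ext u k : vlast (ext u k) = k.
Proof. by rewrite /vlast ext_last. Qed.

Definition vgam v : R := (vlast v).+1%:R^-1 / kappa.

Definition vtheta n : R := kappa * 2 ^+ n.

Lemma vtheta_ge1 n : 1 <= vtheta n.
Proof. by rewrite mulr_ege1// exprn_ege1// ler1n. Qed.

Lemma lambdaE v : lambda R v = vgam v * vtheta (vlevel (par v)).
Proof.
have -> : lambda R v = 2 ^ (isum (\val v) (vm (\val v)) (vM (\val v))) /
    (\val v (vM (\val v)) + 1)%:~R by [].
rewrite (isum_edge (edge_par v)) -(gez0_abs (vsum_ge0 (par v))) -/(vlevel (par v)).
rewrite -(gez0_abs (V_ge0 (lexx (vM (\val v))))) -/(vlast v) -exprnP.
have -> : (vlast v)%:Z + 1 = (vlast v).+1%:Z by lia.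
by rewrite /vgam /vtheta mulrA divfK// mulrC.
Qed.

Let esum_children u (F : nat -> R) : \esum_(v in [set v | par v == u]) (F (vlast v))%:E =
  \esum_(k in [set: nat]) (F k)%:E.
Proof.
rewrite (@reindex_esum R _ _ _ _ _ (fun v => (F (vlast v))%:E) (ext_bij u)); apply: eq_esum => k _.
by rewrite vlast_ext.
Qed.

Lemma vgam1 u :
  \esum_(v in [set: V]) (if par v == u then vgam v ^+ 2 else 0)%:E = 1%:E.
Proof.
transitivity (\esum_(v in [set v | par v == u]) ((kappa ^+ 2)^-1 * sq (vlast v))%:E).
  rewrite [RHS]esum_mkcond; apply: eq_esum => v _.
  have -> : (v \in [set v | par v == u]) = (par v == u).
    by apply/idP/idP => [/set_mem|h]//; exact: mem_set.
  by case: eqP => // _; rewrite /vgam /sq exprMn !exprVn mulrC.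
rewrite (esum_children u (fun k => (kappa ^+ 2)^-1 * sq k)).
under eq_esum do rewrite EFinM.
rewrite esumZr ?invr_ge0 ?sqr_ge0// kappa2 -EFinM mulVf// expf_neq0//.
Qed.

Lemma Chi_lambda u :
  (\esum_(v in Chi u) (lambda R v ^+ 2)%:E)%E = (vtheta (vlevel u) ^+ 2)%:E.
Proof.
have -> : Chi u = [set v | par v == u].
  by apply/seteqP; split=> v; rewrite /Chi /= parE => /asboolP.
transitivity (\esum_(v in [set v | par v == u])
    ((4 ^+ vlevel u) * sq (vlast v))%:E).
  apply: eq_esum => v /= /eqP pv; rewrite lambdaE pv /vgam /vtheta /sq; congr EFin.
  rewrite mulrA divfK// exprMn exprVn mulrC; congr (_ * _).
  by rewrite -exprM mulnC exprM; congr (_ ^+ _); ring.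
rewrite (esum_children u (fun k => 4 ^+ vlevel u * sq k)).
under eq_esum do rewrite EFinM.
rewrite esumZr ?exprn_ge0// kappa2 -EFinM /vtheta exprMn mulrC.
by congr (_ * _)%:E; rewrite -exprM mulnC exprM; congr (_ ^+ _); ring.
Qed.

Lemma weighted_shiftE : weighted_shift R = level_shift par vgam vlevel vtheta.
Proof.
apply/seteqP; split=> [[f g] [/= fin fg]|[f g] [/= fin fg]]; split=> /=.
- by move: fin; under eq_esum do rewrite Chi_lambda -EFinM.
- by move=> v; rewrite fg lambdaE.
- by under eq_esum do rewrite Chi_lambda -EFinM.
- by move=> v; rewrite fg lambdaE.
Qed.

Lemma aluthge_coef_ext t w k :
  aluthge_coef par vgam vlevel vtheta t (ext w k) =
  2 ^+ vlevel w * (2 `^ (1 - t)) ^+ k / k.+1%:R.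
Proof.
have a0 : 0 < vtheta (vlevel w) by exact: lt_le_trans (vtheta_ge1 _).
rewrite /aluthge_coef par_ext vlevel_ext /vgam vlast_ext.
have -> : vtheta (vlevel w + k) = vtheta (vlevel w) * 2 ^+ k.
  by rewrite /vtheta exprD mulrA.
rewrite powRM ?exprn_ge0 ?ltW// -(@powR_mulrn _ 2 k)// -powRrM mulrC.
have -> : 2 `^ (k%:R * (1 - t)) = (2 `^ (1 - t)) ^+ k :> R.
  by rewrite mulrC powRrM powR_mulrn// powR_ge0.
have tt : vtheta (vlevel w) `^ t * vtheta (vlevel w) `^ (1 - t) =
    kappa * 2 ^+ vlevel w.
  by rewrite -powRD ?subrKC ?powRr1 ?ltW//; apply/implyP; rewrite gt_eqF.
transitivity (kappa * 2 ^+ vlevel w * (2 `^ (1 - t)) ^+ k / k.+1%:R / kappa).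
  by rewrite -tt; ring.
have k0 : k.+1%:R != 0 :> R by rewrite pnatr_eq0.
move: (k.+1%:R) k0 => x x0; by field; rewrite x0 kappa_neq0.
Qed.

(** With r the square root of q, Bernoulli's inequality bounds r^k below by a
    multiple of k + 1, so that q^k / (k + 1) grows at least linearly. *)
Lemma expr_div_unbounded (q M : R) : 1 < q -> exists k, M < q ^+ k / k.+1%:R.
Proof.
move=> q1; pose r := Num.sqrt q; have q0 : 0 < q by exact: lt_trans q1.
have r1 : 1 < r by rewrite -[ltLHS]sqrtr1 ltr_sqrt.
pose d := Num.min 1 (r - 1).
have d0 : 0 < d by rewrite lt_min ltr01 subr_gt0.
have rk k : d * k.+1%:R <= r ^+ k.
  elim: k => [|k ih]; first by rewrite mulr1 ge_min lexx.
  have dr : d <= r - 1 by rewrite ge_min lexx orbT.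
  have rk1 : 1 <= r ^+ k by rewrite exprn_ege1// ltW.
  rewrite exprS -natr1 mulrDr mulr1; nra.
have [k kM] : exists k : nat, M / d ^+ 2 < k%:R.
  by exists (Num.truncn (M / d ^+ 2)).+1; exact: truncnS_gt.
exists k; rewrite -[q]sqr_sqrtr ?ltW// -/r -exprM mulnC exprM.
rewrite ltr_pdivlMr ?ltr0n//.
have dk0 : 0 <= d * k.+1%:R by rewrite mulr_ge0// ltW.
apply: (@lt_le_trans _ _ ((d * k.+1%:R) ^+ 2)); last by rewrite lerXn2r ?nnegrE// (le_trans dk0).
rewrite exprMn expr2 [k.+1%:R ^+ 2]expr2 mulrA ltr_pM2r ?ltr0n//.
move: kM; rewrite ltr_pdivrMr ?exprn_gt0// expr2 => kM; apply: lt_le_trans kM _.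
by rewrite mulrC; apply: ler_wpM2l; rewrite ?ler_nat// mulr_ge0// ltW.
Qed.

End Weights.

Theorem corollary6p5 (R : realType) (t : R) (t_gt0 : 0 < t) (t_lt1 : t < 1) :
  ~ closable (aluthge t (adjoint (weighted_shift R))).
Proof.
have [w _] := V_inhabited; rewrite weighted_shiftE.
apply: (@aluthge_not_closable _ _ _ _ _ _ (vgam1 R) (vtheta_ge1 R) t w t_gt0) => M.
have q1 : 1 < 2 `^ (1 - t) :> R.
  have e1 : 1 = 1 `^ (1 - t) :> R by rewrite powR1.
  by rewrite [ltLHS]e1; apply: gt0_ltr_powR; rewrite ?subr_gt0 ?nnegrE ?ltr1n.
have [k Mk] := expr_div_unbounded M q1.
exists (ext w k); first exact: par_ext.
rewrite aluthge_coef_ext; apply: lt_le_trans Mk _.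
by rewrite -mulrA ler_peMl// exprn_ege1// ler1n.
Qed.
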